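(* Let $\mathbf{p}=(\mathbf{p}_1,\dots,\mathbf{p}_N)$ be a configuration of points in $\mathbb{E}^n$. Then the functions $V_n(\mathbf{p},r)=\mathrm{Vol}_n[\bigcup_{i=1}^NB_n(\mathbf{p}_i,r)]$ and $V^n(\mathbf{p},r)=\mathrm{Vol}_n[\bigcap_{i=1}^NB_n(\mathbf{p}_i,r)]$ are, for all sufficiently large real $r$, the restrictions of functions holomorphic in a punctured neighborhood $\{r\in\mathbb{C}:|r|>R\}$ of $r=\infty$, each having a pole of order exactly $n$ at $r=\infty$.
   Context: $B_n(\mathbf{x},r)$ denotes the closed $n$-dimensional ball of radius $r$ centered at $\mathbf{x}$, and $\mathrm{Vol}_n$ is $n$-dimensional volume. *)

(* Defs.v *)
From HB Require Import structures.
From mathcomp Require Import all_boot all_order all_algebra.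
From mathcomp Require Import all_classical all_reals all_analysis.
From mathcomp Require Import complex.
Set Implicit Arguments. Unset Strict Implicit. Unset Printing Implicit Defensive.
Import Order.TTheory GRing.Theory Num.Theory.
Import numFieldTopology.Exports.
HB.instance Definition _ (R : rcfType) := PseudoPointedMetric.copy R[i] (R[i])^o.
Local Open Scope classical_set_scope.
Local Open Scope ring_scope.
Local Open Scope complex_scope.

Section Vol.
Variable R : realType.

Definition eucl_dist (n : nat) (x y : 'rV[R]_n) : R :=
  Num.sqrt (\sum_(i < n) (y ord0 i - x ord0 i) ^+ 2).

Definition cball (n : nat) (x : 'rV[R]_n) (r : R) : set 'rV[R]_n :=
  [set y | eucl_dist x y <= r].

Definition rcons_pt (n : nat) (t : R) (v : 'rV[R]_n) : 'rV[R]_n.+1 :=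
  \row_(i < n.+1) match unlift ord0 i with Some j => v ord0 j | None => t end.

Fixpoint vol (n : nat) : set 'rV[R]_n -> \bar R :=
  match n with
  | 0 => fun A => ((\1_A) (0 : 'rV[R]_0))%:E
  | n'.+1 => fun A =>
      (\int[@lebesgue_measure R]_t vol [set v | A (rcons_pt t v)])%E
  end.

Local Notation C := R[i].

Definition holomorphic_on (U : set C) (f : C -> C) : Prop :=
  open U /\ forall z, U z ->
    exists l : C, (fun h : C => (f (z + h) - f z) / h) @ 0^' --> l.

Definition pole_at_infinity_of_order (R0 : R) (f : C -> C) (n : nat) : Prop :=
  exists (rho : R) (h : C -> C), 0 < rho /\
    holomorphic_on [set w : C | `|w| < rho%:C] h /\ h 0 != 0 /\
    forall w : C, 0 < `|w| -> `|w| < rho%:C -> R0%:C < `|w^-1| ->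
      f w^-1 = h w / w ^+ n.
Definition vol_union (n N : nat) (p : 'I_N -> 'rV[R]_n) (r : R) : \bar R :=
  vol (\bigcup_(i in [set: 'I_N]) cball (p i) r).

Definition vol_inter (n N : nat) (p : 'I_N -> 'rV[R]_n) (r : R) : \bar R :=
  vol (\bigcap_(i in [set: 'I_N]) cball (p i) r).
End Vol.

(* Main.v *)
Require Import Defs.
From HB Require Import structures.
From mathcomp Require Import all_boot all_order all_algebra.
From mathcomp Require Import all_classical all_reals all_analysis.
From mathcomp Require Import measurable_realfun.
From mathcomp Require Import complex ring lra.
Set Implicit Arguments. Unset Strict Implicit. Unset Printing Implicit Defensive.
Import Order.TTheory GRing.Theory Num.Theory.
Import numFieldTopology.Exports.
Local Open Scope classical_set_scope.
Local Open Scope ring_scope.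
Local Open Scope complex_scope.

(** Cutting space into the nearest-point (for the union) or farthest-point (for
    the intersection) Voronoi cells of the [p i] turns both volumes into finite
    sums of volumes of [B (p, r)] cut by a polyhedron.

    If the bounding hyperplanes of the polyhedron have a common point, it is a
    translated cone [K], and the volume of [B (p, r)] cut by [K] is
    [r ^ n * h (1 / r)], where [h w] is the integral over the unit ball of [K] of
    the [n]-th power of the radial function
    [w t + sqrt (1 - w ^ 2 (|p| ^ 2 - t ^ 2))], with [t y = <p, y> / |y|]; this
    integrand is holomorphic in [w] near [0], uniformly in [y]. Otherwise there
    are multipliers [lam i] with [sum lam i a i = 0] and [sum lam i b i = -1];
    replacing a half-space by its complement changes the volume, up to sign, by
    the volume for one half-space less, and complementing those with
    [lam i < 0] makes the polyhedron empty, so induction on the number of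
    half-spaces applies.

    Finally [h 0 != 0], because both bodies contain the ball of radius [r / 2]
    about [0], so that the volume is at least a positive multiple of [r ^ n]. *)

(** * The iterated integral as a measure *)

Section RowMeasurable.
Context {R : realType} (n : nat).

Let coords : 'I_n -> 'rV[R]_n -> R := fun i x => x ord0 i.

Let row_set0 : g_sigma_preimage coords set0.
Proof. exact: sigma_algebra0. Qed.

Let row_setC A : g_sigma_preimage coords A -> g_sigma_preimage coords (~` A).
Proof. exact: sigma_algebraC. Qed.

Let row_bigcup (F : _^nat) : (forall i, g_sigma_preimage coords (F i)) ->
  g_sigma_preimage coords (\bigcup_i (F i)).
Proof. exact: sigma_algebra_bigcup. Qed.

(** Row vectors carry the sigma-algebra generated by the coordinates, so that a map into them is
    measurable as soon as its coordinates are. *)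
HB.instance Definition _ := @isMeasurable.Build default_measure_display
  'rV[R]_n (g_sigma_preimage coords) row_set0 row_setC row_bigcup.

End RowMeasurable.

Lemma measurable_coord (R : realType) n (i : 'I_n) :
  measurable_fun [set: 'rV[R]_n] (fun x => x ord0 i).
Proof.
move=> _ Y mY; rewrite setTI; apply: sub_sigma_algebra => /=.
rewrite -bigcup_seq/=; exists i => /=; first by rewrite mem_index_enum.
by exists Y => //; rewrite setTI.
Qed.

Lemma measurable_fun_rowP (R : realType) d (T : measurableType d) n
    (f : T -> 'rV[R]_n) :
  (forall i, measurable_fun [set: T] (fun x => f x ord0 i)) ->
  measurable_fun [set: T] f.
Proof.
move=> mf.
have : g_sigma_preimage (fun i x => f x ord0 i) `<=` @measurable d T.
  apply: smallest_sub; first exact: sigma_algebra_measurable.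
  case: n => [|n] in f mf *; first by rewrite big_ord0.
  by rewrite -bigcup_mkord_ord; apply: bigcup_sub => i Ii A [B mB <-]; exact: mf.
rewrite (g_sigma_preimage_comp (fun i (x : 'rV[R]_n) => x ord0 i) f) => H _ A mA.
by apply: H; exists A.
Qed.

Lemma rcons_pt0 (R : realType) n t (v : 'rV[R]_n) : rcons_pt t v ord0 ord0 = t.
Proof. by rewrite mxE unlift_none. Qed.

Lemma rcons_ptS (R : realType) n t (v : 'rV[R]_n) i :
  rcons_pt t v ord0 (lift ord0 i) = v ord0 i.
Proof. by rewrite mxE liftK. Qed.

Lemma measurable_rcons_pt (R : realType) n :
  measurable_fun [set: R * 'rV[R]_n] (fun z => rcons_pt z.1 z.2).
Proof.
apply: measurable_fun_rowP => i; case: (unliftP ord0 i) => [j ->|->].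
  under eq_fun do rewrite rcons_ptS.
  exact: (measurableT_comp (measurable_coord j) measurable_snd).
under eq_fun do rewrite rcons_pt0.
exact: measurable_fst.
Qed.

Definition box {R : realType} n (a : R) : set 'rV[R]_n :=
  [set v | forall i, `|v ord0 i| <= a].
Arguments box {R} n a.

Lemma measurable_box (R : realType) n (a : R) : measurable (box n a).
Proof.
rewrite (_ : box n a = \bigcap_(i in [set: 'I_n])
    ((fun v : 'rV[R]_n => v ord0 i) @^-1` `[- a, a]%classic)); last first.
  apply/seteqP; split => v /=.
    by move=> H i _ /=; rewrite in_itv/= -ler_norml.
  by move=> H i; have := H i I; rewrite /= in_itv/= -ler_norml.
apply: fin_bigcap_measurable => // i _; rewrite -[X in measurable X]setTI.
exact: measurable_coord.
Qed.

Lemma bigcup_box (R : realType) n : \bigcup_k box n k%:R = [set: 'rV[R]_n].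
Proof.
apply/seteqP; split => // v _.
exists (Num.bound (\sum_i `|v ord0 i|)) => // i.
apply: le_trans (ltW (archi_boundP _)); last exact: sumr_ge0.
by rewrite (bigD1 i)//= lerDl; exact: sumr_ge0.
Qed.

Lemma box_rcons (R : realType) n (a t : R) :
  [set v | box n.+1 a (rcons_pt t v)] =
  [set v : 'rV[R]_n | `|t| <= a /\ box n a v].
Proof.
apply/seteqP; split => v /=.
  move=> H; split; first by have := H ord0; rewrite rcons_pt0.
  by move=> i; have := H (lift ord0 i); rewrite rcons_ptS.
move=> [ta H] i; case: (unliftP ord0 i) => [j ->|->].
  by rewrite rcons_ptS.
by rewrite rcons_pt0.
Qed.

Section VolMeasure.
Context {R : realType}.
Local Open Scope ereal_scope.

(** One induction yields both claims. In dimension [n + 1] the volume is the image under [rcons_pt]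
    of the product of Lebesgue measure with the volume in dimension [n]; the boxes, of finite
    volume, exhaust the space and give the sigma-finiteness that the next product needs. *)
Lemma vol_measure_rec n :
  (exists m : {sigma_finite_measure set 'rV[R]_n -> \bar R},
    (m : set _ -> _) = @vol R n) /\
  (forall a : R, (0 <= a)%R -> vol (box n a) = ((2 * a) ^+ n)%:E).
Proof.
elim: n => [|n [[m mE] IH]].
  split; last first.
    move=> a a0 /=; rewrite expr0 indicE mem_set//= => -[]//.
  exists (\d_(0%R : 'rV[R]_0)).
  by apply/funext => A.
have vol_box (a : R) : (0 <= a)%R -> vol (box n.+1 a) = ((2 * a) ^+ n.+1)%:E.
  move=> a0 /=.
  transitivity (\int[@lebesgue_measure R]_t
      (((2 * a) ^+ n)%:E * (\1_(`[- a, a]%classic) t)%:E)); last first.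
    rewrite ge0_integralZl//; last 2 first.
    - by apply/measurable_EFinP; exact: measurable_indic.
    - by rewrite lee_fin exprn_ge0// mulr_ge0.
    rewrite integral_indic//= setIT lebesgue_measure_itv/= lte_fin.
    rewrite exprSr EFinM.
    have [aa|] := ltP (- a)%R a; first by rewrite -EFinD; congr (_ * _%:E); ring.
    move=> aa; have -> : a = 0%R by lra.
    by rewrite mulr0.
  apply: eq_integral => t _; rewrite box_rcons.
  rewrite indicE; have [ta|/negP ta] := boolP (`|t| <= a)%R.
    rewrite mem_set/= ?in_itv/= -?ler_norml// mule1 -IH//; congr vol.
    by apply/seteqP; split => v /=; [case|].
  rewrite memNset/= ?in_itv/= -?ler_norml// mule0 -mE.
  rewrite [X in m X](_ : _ = set0) ?measure0//.
  by apply/seteqP; split => v //= [].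
split => //.
pose f (z : (measurableTypeR R * 'rV[R]_n)%type) := rcons_pt z.1 z.2.
have mf : measurable_fun setT f := @measurable_rcons_pt R n.
pose mu := pushforward (@lebesgue_measure R \x m) f.
have muE : mu = @vol R n.+1.
  apply/funext => A /=; rewrite /mu /pushforward /product_measure1.
  apply: eq_integral => t _ /=; rewrite -mE; congr (m _).
  by apply/seteqP; split => v; rewrite /xsection/= inE.
pose mu' := measure_function_pushforward__canonical__measure_function_Measure
  (@lebesgue_measure R \x m) mf.
have sf : sigma_finite setT mu'.
  exists (fun k => box n.+1 k%:R); first by rewrite bigcup_box.
  move=> k; split; first exact: measurable_box.
  rewrite [mu' _](_ : _ = mu (box n.+1 k%:R))// muE vol_box//.
  exact: ltry.
pose m1 := Measure_isSigmaFinite.Build _ _ _ mu' sf.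
pose m2 : {sigma_finite_measure set 'rV[R]_n.+1 -> \bar R} :=
  HB.pack (Measure.sort mu') mu' m1.
by exists m2; rewrite -muE.
Qed.
End VolMeasure.

(** * Volume under dilations and translations *)

Section VolTheory.
Context {R : realType}.
Local Open Scope ereal_scope.

Let vol0 n : @vol R n set0 = 0.
Proof. by have [[m <-] _] := @vol_measure_rec R n; rewrite measure0. Qed.

Let vol_ge0 n A : 0 <= @vol R n A.
Proof. by have [[m <-] _] := @vol_measure_rec R n; rewrite measure_ge0. Qed.

Let vol_sigma_additive n : semi_sigma_additive (@vol R n).
Proof.
by have [[m <-] _] := @vol_measure_rec R n; exact: measure_semi_sigma_additive.
Qed.

HB.instance Definition _ n := isMeasure.Build _ _ _ (@vol R n)
  (@vol0 n) (@vol_ge0 n) (@vol_sigma_additive n).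

Let vol_sigma_finite n : sigma_finite setT (@vol R n).
Proof. by have [[m <-] _] := @vol_measure_rec R n; exact: sigma_finiteT. Qed.

HB.instance Definition _ n := Measure_isSigmaFinite.Build _ _ _ (@vol R n)
  (@vol_sigma_finite n).

Lemma vol_box n (a : R) : (0 <= a)%R -> vol (box n a) = ((2 * a) ^+ n)%:E.
Proof. by have [_] := @vol_measure_rec R n; exact. Qed.

Lemma measurable_slice n (A : set 'rV[R]_n.+1) (t : R) : measurable A ->
  measurable [set v | A (rcons_pt t v)].
Proof.
move=> mA; rewrite -[X in measurable X]setTI.
have : measurable_fun [set: 'rV[R]_n] (rcons_pt t); last exact.
apply: measurable_fun_rowP => i; case: (unliftP ord0 i) => [j ->|->].
  under eq_fun do rewrite rcons_ptS.
  exact: measurable_coord.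
by under eq_fun do rewrite rcons_pt0; exact: measurable_cst.
Qed.

Lemma measurable_vol_slice n (A : set 'rV[R]_n.+1) : measurable A ->
  measurable_fun [set: measurableTypeR R]
    (fun t => vol [set v | A (rcons_pt t v)]).
Proof.
move=> mA; pose f (z : (measurableTypeR R * 'rV[R]_n)%type) := rcons_pt z.1 z.2.
have mf : measurable_fun setT f := @measurable_rcons_pt R n.
have mfA : measurable (f @^-1` A) by rewrite -[X in measurable X]setTI; exact: mf.
have := measurable_fun_xsection (@vol R n) mfA.
congr measurable_fun; apply/funext => t /=; congr vol.
by apply/seteqP; split => v; rewrite /xsection/= inE.
Qed.

(** The image of Lebesgue measure under [a * t + b], scaled by [a], agrees with Lebesgue measure on
    half-open intervals, hence on all measurable sets by uniqueness. *)
Lemma integral_affine (a b : R) (g : R -> \bar R) : (0 < a)%R ->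
  measurable_fun [set: measurableTypeR R] g -> (forall t, 0 <= g t) ->
  \int[@lebesgue_measure R]_t g (a * t + b)%R =
  a^-1%:E * \int[@lebesgue_measure R]_t g t.
Proof.
move=> a0 mg g0.
pose phi (t : measurableTypeR R) : measurableTypeR R := (a * t + b)%R.
have mphi : measurable_fun setT phi.
  by apply: measurable_funD => //; exact: measurable_funM.
pose nu := mscale (NngNum (ltW a0))
  (measure_function_pushforward__canonical__measure_function_Measure
    (@lebesgue_measure R) mphi).
have nuE : forall X, measurable X -> lebesgue_measure X = nu X.
  apply: lebesgue_measure_unique => _ [[x y]] _ <-.
  transitivity (a%:E * lebesgue_measure (phi @^-1` `]x, y]%classic)); last by [].
  rewrite [X in _ * lebesgue_measure X](_ : _ =
      `](x - b) / a, (y - b) / a]%classic)%R; last first.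
    apply/seteqP; split => t; rewrite /phi/= !in_itv/=.
      by rewrite ltr_pdivrMr// ler_pdivlMr// mulrC ltrBlDr lerBrDr.
    by rewrite ltr_pdivrMr// ler_pdivlMr// mulrC ltrBlDr lerBrDr.
  rewrite !lebesgue_measure_itv/= !lte_fin ltr_pM2r ?invr_gt0// ltrD2r.
  case: ifP => _; last by rewrite mule0.
  by rewrite -!EFinD -EFinM; congr EFin; field; rewrite gt_eqF.
rewrite [in RHS](eq_measure_integral nu); last by move=> A mA _; exact: nuE.
rewrite ge0_integral_mscale// ge0_integral_pushforward//.
rewrite muleA -EFinM mulVf ?gt_eqF// mul1e.
by rewrite preimage_setT.
Qed.

(** The slice of the preimage at [t] is the preimage of the slice of [A] at [a t + b_0], so each
    dimension contributes one factor [1 / a]. *)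
Lemma vol_affine n (a : R) (b : 'rV[R]_n) (A : set 'rV[R]_n) :
  (0 < a)%R -> measurable A ->
  vol [set x | A (a *: x + b)%R] = (a ^- n)%:E * vol A.
Proof.
move=> a0; elim: n => [|n IH] in b A *.
  move=> _ /=; rewrite expr0 invr1 mul1e; congr (_%:E); congr (\1_ _ _).
  by apply/seteqP; split => x /=; rewrite (thinmx0 (_ + _)%R) (thinmx0 x).
move=> mA /=.
pose b' : 'rV[R]_n := \row_j b ord0 (lift ord0 j).
transitivity (\int[@lebesgue_measure R]_t ((a ^- n)%:E *
    vol [set v | A (rcons_pt (a * t + b ord0 ord0)%R v)])).
  apply: eq_integral => t _.
  rewrite -(IH b'); last exact: measurable_slice.
  congr vol; apply/seteqP; split => v /=.
    congr A; apply/rowP => i; case: (unliftP ord0 i) => [j ->|->].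
      by rewrite !mxE liftK !mxE.
    by rewrite !mxE unlift_none.
  congr A; apply/rowP => i; case: (unliftP ord0 i) => [j ->|->].
    by rewrite !mxE liftK !mxE.
  by rewrite !mxE unlift_none.
rewrite ge0_integralZl//; last 2 first.
- have mphi : measurable_fun [set: measurableTypeR R]
      (fun t : measurableTypeR R => (a * t + b ord0 ord0)%R : measurableTypeR R).
    by apply: measurable_funD => //; exact: measurable_funM.
  exact: (measurableT_comp (measurable_vol_slice mA) mphi).
- by rewrite lee_fin invr_ge0 exprn_ge0// ltW.
rewrite (@integral_affine a _ (fun t => vol [set v | A (rcons_pt t v)]))//;
  last exact: measurable_vol_slice.
by rewrite muleA -EFinM -invfM exprSr.
Qed.

End VolTheory.

(** * Euclidean balls and polar integration over cones *)

Section MeasurableReal.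
Context {R : realType}.

Lemma measurable_sqrt : measurable_fun setT (@Num.sqrt R).
Proof. by apply: continuous_measurable_fun; exact: sqrt_continuous. Qed.

Lemma measurable_funV d (T : measurableType d) (f : T -> R) :
  measurable_fun setT f -> measurable_fun setT (fun x => (f x)^-1).
Proof.
move=> mf.
(* A real power of the nonnegative square replaces the inverse, so that measurability of powers
   applies; at a zero of [f] both sides vanish. *)
rewrite (_ : (fun x => _) = (fun x => f x * (f x ^+ 2) `^ (-1))); last first.
  apply/funext => x; rewrite powR_inv1 ?sqr_ge0//.
  have [->|fx0] := eqVneq (f x) 0; first by rewrite invr0 mul0r.
  by field.
apply: measurable_funM => //.
apply: (measurableT_comp (measurable_powR (-1))).
exact: measurable_funX.
Qed.

Lemma measurable_le_set d (T : measurableType d) (f g : T -> R) :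
  measurable_fun setT f -> measurable_fun setT g -> measurable [set x | f x <= g x].
Proof.
move=> mf mg; rewrite -[X in measurable X]setTI.
exact: measurable_fun_ler mf mg measurableT [set true] _.
Qed.

Lemma measurable_lt_set d (T : measurableType d) (f g : T -> R) :
  measurable_fun setT f -> measurable_fun setT g -> measurable [set x | f x < g x].
Proof.
move=> mf mg; rewrite -[X in measurable X]setTI.
exact: measurable_fun_ltr mf mg measurableT [set true] _.
Qed.

End MeasurableReal.

Section Euclid.
Context {R : realType} (n : nat).
Implicit Types (a p x y : 'rV[R]_n) (c r : R).

Definition dot a x : R := \sum_i a ord0 i * x ord0 i.
Definition enorm x : R := Num.sqrt (dot x x).

Lemma dotC a x : dot a x = dot x a.
Proof. by apply: eq_bigr => i _; rewrite mulrC. Qed.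

Lemma dotDr a x y : dot a (x + y) = dot a x + dot a y.
Proof. by rewrite -big_split; apply: eq_bigr => i _; rewrite mxE mulrDr. Qed.

Lemma dotZr a c x : dot a (c *: x) = c * dot a x.
Proof. by rewrite mulr_sumr; apply: eq_bigr => i _; rewrite mxE mulrCA. Qed.

Lemma dotDl a x y : dot (x + y) a = dot x a + dot y a.
Proof. by rewrite dotC dotDr !(dotC a). Qed.

Lemma dotZl a c x : dot (c *: x) a = c * dot x a.
Proof. by rewrite dotC dotZr dotC. Qed.

Lemma dotNl a x : dot (- x) a = - dot x a.
Proof. by rewrite -scaleN1r dotZl mulN1r. Qed.

Lemma dotNr a x : dot a (- x) = - dot a x.
Proof. by rewrite dotC dotNl dotC. Qed.

Lemma dot_ge0 x : 0 <= dot x x.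
Proof. by apply: sumr_ge0 => i _; rewrite -expr2 sqr_ge0. Qed.

Lemma enorm_ge0 x : 0 <= enorm x.
Proof. exact: sqrtr_ge0. Qed.

Lemma sqr_enorm x : enorm x ^+ 2 = dot x x.
Proof. exact: sqr_sqrtr (dot_ge0 x). Qed.

Lemma enormZ c x : 0 <= c -> enorm (c *: x) = c * enorm x.
Proof.
move=> c0; rewrite /enorm dotZr dotZl mulrA -expr2 sqrtrM ?sqr_ge0//.
by rewrite sqrtr_sqr ger0_norm.
Qed.

Lemma eucl_distE x y : eucl_dist x y = enorm (y - x).
Proof.
by congr Num.sqrt; apply: eq_bigr => i _; rewrite !mxE expr2.
Qed.

Lemma le_coord_enorm x i : `|x ord0 i| <= enorm x.
Proof.
rewrite -sqrtr_sqr ler_wsqrtr// /dot (bigD1 i)//= -expr2 lerDl.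
by apply: sumr_ge0 => j _; rewrite -expr2 sqr_ge0.
Qed.

Lemma le_dot_enorm p x : `|dot p x| <= (\sum_i `|p ord0 i|) * enorm x.
Proof.
rewrite mulr_suml (le_trans (ler_norm_sum _ _ _))//; apply: ler_sum => i _.
by rewrite normrM ler_wpM2l// le_coord_enorm.
Qed.

Lemma cballP p r x : 0 <= r ->
  cball p r x <-> dot x x - 2 * dot p x + dot p p <= r ^+ 2.
Proof.
move=> r0; rewrite /cball/= eucl_distE.
have -> : dot x x - 2 * dot p x + dot p p = enorm (x - p) ^+ 2.
  by rewrite sqr_enorm !(dotDl, dotDr, dotNl, dotNr) (dotC x p); ring.
by rewrite ler_pXn2r// nnegrE enorm_ge0.
Qed.

Lemma measurable_dot a : measurable_fun setT (dot a).
Proof.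
apply: measurable_sum => i; apply: measurable_funM => //.
exact: measurable_coord.
Qed.

Lemma measurable_enorm : measurable_fun setT enorm.
Proof.
apply: (measurableT_comp measurable_sqrt).
by apply: measurable_sum => i; apply: measurable_funM; exact: measurable_coord.
Qed.

Lemma measurable_cball p r : measurable (cball p r).
Proof.
rewrite (_ : cball p r = [set x | enorm (x - p) <= r]); last first.
  by apply/seteqP; split => x; rewrite /cball/= eucl_distE.
apply: measurable_le_set => //.
apply: (measurableT_comp measurable_enorm); apply: measurable_fun_rowP => i.
under eq_fun do rewrite !mxE.
by apply: measurable_funB => //; exact: measurable_coord.
Qed.

Lemma vol_bounded (A : set 'rV[R]_n) (r : R) : measurable A ->
  (forall x, A x -> enorm x <= r) -> (vol A < +oo)%E.
Proof.
move=> mA Ar; apply: (@le_lt_trans _ _ (vol (box n `|r|))); last first.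
  by rewrite vol_box// ltry.
apply: le_measure; rewrite ?inE//; first exact: measurable_box.
move=> x Ax i; apply: le_trans (le_coord_enorm x i) _.
by apply: le_trans (Ar _ Ax) _; exact: ler_norm.
Qed.

Lemma vol_cball_fin p r : (vol (cball p r) < +oo)%E.
Proof.
pose B := [set y : 'rV[R]_n | enorm y <= r].
have mB : measurable B by apply: measurable_le_set => //; exact: measurable_enorm.
rewrite (_ : cball p r = [set x | B (1 *: x - p)]); last first.
  by apply/seteqP; split => x; rewrite /cball/= eucl_distE scale1r.
rewrite vol_affine// expr1n invr1 mul1e; exact: (@vol_bounded _ r).
Qed.

Lemma vol_unit_ball_gt0 : (0 < vol [set x : 'rV[R]_n | (enorm x <= 1)%R])%E.
Proof.
pose e : R := n.+1%:R^-1.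
have e0 : 0 < e by rewrite invr_gt0.
(* With [e = 1 / (n + 1)] the cube lies in the ball, since [n e ^ 2 <= n e <= 1]; the successor also
   covers [n = 0]. *)
apply: (@lt_le_trans _ _ (vol (box n e))).
  by rewrite vol_box ?ltW// lte_fin exprn_gt0// mulr_gt0.
apply: le_measure; rewrite ?inE; first exact: measurable_box.
  by apply: measurable_le_set => //; exact: measurable_enorm.
move=> x xe /=; rewrite -sqrtr1 ler_wsqrtr//.
apply: (@le_trans _ _ (\sum_(i < n) e)).
  apply: ler_sum => i _; rewrite -expr2 -real_normK ?num_real// expr2.
  rewrite -[leRHS]mulr1; apply: ler_pM => //.
  by apply: le_trans (xe i) _; rewrite invf_le1 ?ler1n.
by rewrite sumr_const card_ord -mulr_natl ler_pdivrMr// mul1r ler_nat.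
Qed.

End Euclid.

(** * Star-shaped bodies over cones *)

Section Polar.
Context {R : realType} (n : nat).
Implicit Types (C D : set 'rV[R]_n) (rho : 'rV[R]_n -> R).

Definition cone C := forall (c : R) x, 0 < c -> C (c *: x) <-> C x.
Definition homog0 rho := forall (c : R) x, 0 < c -> rho (c *: x) = rho x.
(** For a cone [C] and [rho] homogeneous of degree 0, this is the star-shaped part of [C] with
    radial function [rho]. *)
Definition star C rho := C `&` [set y | enorm y <= rho y].

Lemma measurable_star C rho : measurable C -> measurable_fun setT rho ->
  measurable (star C rho).
Proof.
move=> mC mr; apply: measurableI => //.
by apply: measurable_le_set => //; exact: measurable_enorm.
Qed.

Lemma vol_star_dilate D rho (c : R) : 0 < c -> cone D -> homog0 rho ->
  measurable D -> measurable_fun setT rho ->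
  vol (star D (fun y => c * rho y)) = ((c ^+ n)%:E * vol (star D rho))%E.
Proof.
move=> c0 cD hr mD mr.
have c'0 : 0 < c^-1 by rewrite invr_gt0.
rewrite (_ : star D _ = [set x | star D rho (c^-1 *: x + 0)]); last first.
  apply/seteqP; split => x [/= Dx xc]; split; rewrite /= ?addr0 in Dx xc *.
  - exact/cD.
  - by rewrite hr// (enormZ _ (ltW c'0)) ler_pdivrMl.
  - exact/(cD _ _ c'0).
  - by move: xc; rewrite hr// (enormZ _ (ltW c'0)) ler_pdivrMl.
by rewrite vol_affine// ?exprVn ?invrK//; exact: measurable_star.
Qed.

(** Both quantities are compared with the volume of [star D (cst c)], which is [c ^ n] times that of
    the unit part of [D]; the factor [q] pays for the passage from [c] back to [rho]. *)
Lemma star_bounds D rho (c q : R) : 0 < c -> 0 < q -> cone D -> homog0 rho ->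
  measurable D -> measurable_fun setT rho ->
  (forall y, D y -> 0 <= rho y /\ rho y <= c <= q * rho y) ->
  (vol (star D rho) <=
     (q ^+ n)%:E * \int[@vol R n]_(y in star D (cst 1%R)) (rho y ^+ n)%:E)%E /\
  (\int[@vol R n]_(y in star D (cst 1%R)) (rho y ^+ n)%:E <=
     (q ^+ n)%:E * vol (star D rho))%E.
Proof.
move=> c0 q0 cD hr mD mr Dc.
have mB : measurable (star D (cst 1%R)) by exact: measurable_star.
have mrn : measurable_fun (star D (cst 1%R)) (fun y => (rho y ^+ n)%:E).
  apply: (@measurable_funS _ _ _ _ setT) => //.
  by apply/measurable_EFinP; exact: measurable_funX.
have rhon0 y : star D (cst 1%R) y -> (0 <= (rho y ^+ n)%:E)%E.
  by move=> [/Dc[r0 _] _]; rewrite lee_fin exprn_ge0.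
have volc : vol (star D (cst c)) = ((c ^+ n)%:E * vol (star D (cst 1%R)))%E.
  rewrite -vol_star_dilate//; congr (vol (star _ _)).
  by apply/funext => y; rewrite mulr1.
split.
  apply: (@le_trans _ _ (vol (star D (cst c)))).
    apply: le_measure; rewrite ?inE; [exact: measurable_star..|].
    move=> y [Dy /= yr]; split => //=; have [_ /andP[rc _]] := Dc _ Dy.
    exact: le_trans rc.
  rewrite volc -integral_cst// -ge0_integralZl//; last first.
    by rewrite lee_fin exprn_ge0// ltW.
  apply: ge0_le_integral => //.
  - by move=> y _; rewrite lee_fin exprn_ge0// ltW.
  - exact: measurable_funeM.
  - move=> y [/Dc[r0 /andP[_ cq]] _]; rewrite -EFinM lee_fin -exprMn.
    by rewrite lerXn2r// nnegrE ?mulr_ge0// ltW.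
apply: (@le_trans _ _ (vol (star D (cst c)))).
  rewrite volc -integral_cst//; apply: ge0_le_integral => //.
    move=> y [/Dc[r0 /andP[rc _]] _]; rewrite lee_fin.
    by rewrite lerXn2r// nnegrE ltW.
rewrite -vol_star_dilate//; apply: le_measure; rewrite ?inE.
- exact: measurable_star.
- by apply: measurable_star => //; exact: measurable_funM.
move=> y [Dy /= yr]; split => //=; have [_ /andP[_ cq]] := Dc _ Dy.
exact: le_trans cq.
Qed.

(* Slice the cone by the values of [rho] into countably many cones on which [rho]
   is constant up to a factor [1 + x], and let [x] tend to [0]. *)
Lemma vol_star C rho (m M : R) : 0 < m -> cone C -> homog0 rho ->
  measurable C -> measurable_fun setT rho -> (forall y, m <= rho y <= M) ->
  vol (star C rho) = (\int[@vol R n]_(y in star C (cst 1%R)) (rho y ^+ n)%:E)%E.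
Proof.
move=> m0 cC hr mC mr mrM.
have rho0 y : 0 < rho y by have /andP[+ _] := mrM y; exact: lt_le_trans.
set V := vol _; set I := (\int[_]_(_ in _) _)%E.
have key (x : R) : 0 < x ->
    (V <= ((1 + x) ^+ n)%:E * I)%E /\ (I <= ((1 + x) ^+ n)%:E * V)%E.
  move=> x0; have q0 : 0 < 1 + x by lra.
  (* Slices of width [m x] suffice: since [rho >= m], the upper end of a slice exceeds [rho] by at
     most [x rho]. *)
  pose d := m * x; have d0 : 0 < d by exact: mulr_gt0.
  pose D (j : nat) := C `&` [set y | j%:R * d <= rho y < j.+1%:R * d].
  have mD j : measurable (D j).
    apply: measurableI => //.
    rewrite (_ : [set y | _] =
        [set y | j%:R * d <= rho y] `&` [set y | rho y < j.+1%:R * d]).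
      by apply: measurableI; [exact: measurable_le_set|exact: measurable_lt_set].
    by apply/seteqP; split => y /= => [/andP[]//|[-> ->]].
  have cD j : cone (D j).
    by move=> c y c0; rewrite /D/= hr//; split => -[/(cC _ _ c0) Cy ?].
  have CD : C = \bigcup_j D j.
    apply/seteqP; split => [y Cy|y [j _ []]//].
    exists (Num.truncn (rho y / d)) => //; split => //=.
    have := truncn_itv (divr_ge0 (ltW (rho0 y)) (ltW d0)).
    by rewrite ler_pdivlMr// ltr_pdivrMr.
  have tD : trivIset setT D.
    move=> i j _ _ [y [[_ /= yi] [_ /= yj]]].
    have tr k : k%:R * d <= rho y < k.+1%:R * d -> Num.truncn (rho y / d) = k.
      by move=> H; apply: truncn_def; rewrite ler_pdivlMr// ltr_pdivrMr.
    by rewrite -(tr i)// -(tr j).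
  have starE r : star C r = \bigcup_j star (D j) r.
    by rewrite {1}CD /star setI_bigcupl.
  have tS r : trivIset setT (fun j => star (D j) r).
    by move=> i j _ _ [y [[yi _] [yj _]]]; apply: tD => //; exists y.
  have VE : V = (\sum_(j <oo) vol (star (D j) rho))%E.
    rewrite /V starE measure_bigcup//; last by move=> j _; exact: measurable_star.
    by apply: eq_eseriesl => j; rewrite in_setT.
  have IE : I = (\sum_(j <oo) \int[@vol R n]_(y in star (D j) (cst 1%R)) (rho y ^+ n)%:E)%E.
    rewrite /I starE ge0_integral_bigcup//.
    - by move=> j; exact: measurable_star.
    - apply: (@measurable_funS _ _ _ _ setT) => //.
      by apply/measurable_EFinP; exact: measurable_funX.
    - by move=> y _; rewrite lee_fin exprn_ge0// ltW.
  have I0 j : (0 <= \int[@vol R n]_(y in star (D j) (cst 1%R)) (rho y ^+ n)%:E)%E.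
    by apply: integral_ge0 => y _; rewrite lee_fin exprn_ge0// ltW.
  have bd j := @star_bounds (D j) rho (j.+1%:R * d) (1 + x).
  have {}bd j : (vol (star (D j) rho) <=
     ((1 + x) ^+ n)%:E * \int[@vol R n]_(y in star (D j) (cst 1%R)) (rho y ^+ n)%:E)%E /\
  (\int[@vol R n]_(y in star (D j) (cst 1%R)) (rho y ^+ n)%:E <=
     ((1 + x) ^+ n)%:E * vol (star (D j) rho))%E.
    apply: bd => //; first by rewrite mulr_gt0.
    move=> y [_ /= /andP[jr rj]]; rewrite ltW// (ltW rj)/=; split => //.
    rewrite -natr1 !mulrDl !mul1r lerD//.
    by rewrite /d mulrC ler_pM2l//; have /andP[] := mrM y.
  rewrite VE IE -!nneseriesZl//; split; apply: lee_nneseries => // j _.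
  - exact: (bd j).1.
  - exact: (bd j).2.
have Vfin : V \is a fin_num.
  rewrite ge0_fin_numE ?measure_ge0//; apply: (@vol_bounded _ _ _ M).
    exact: measurable_star.
  by move=> y [_ /= yr]; apply: le_trans yr _; have /andP[] := mrM y.
have I0 : (0 <= I)%E by apply: integral_ge0 => y _; rewrite lee_fin exprn_ge0// ltW.
have Ifin : I \is a fin_num.
  rewrite ge0_fin_numE//; apply: le_lt_trans (key 1 ltr01).2 _.
  by rewrite -(fineK Vfin) -EFinM ltry.
have lim1 (u v : R) : 0 <= v -> (forall x, 0 < x -> u <= (1 + x) ^+ n * v) -> u <= v.
  move=> v0 H; apply/ler_addgt0Pr => e e0.
  (* On [[0, 1]] the convex function [(1 + x) ^ n] lies below its chord, which makes the excess over
     [v] linear in [x]; the [x] chosen below keeps it under [e]. *)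
  have bern (x : R) : 0 <= x <= 1 -> (1 + x) ^+ n <= 1 + x * (2 ^+ n - 1).
    move=> /andP[x0 x1]; elim: n => [|k IH]; first by rewrite !expr0; lra.
    rewrite exprS (@le_trans _ _ ((1 + x) * (1 + x * (2 ^+ k - 1))))//.
      by rewrite ler_wpM2l// addr_ge0.
    have k1 : 1 <= (2 : R) ^+ k by rewrite exprn_ege1// ler1n.
    have : 0 <= x * (1 - x) * (2 ^+ k - 1) by rewrite !mulr_ge0// subr_ge0.
    by rewrite exprS; lra.
  pose s := 2 ^+ n * v + 1; have s0 : 0 < s by rewrite ltr_wpDl// mulr_ge0// exprn_ge0.
  pose x := Num.min 1 (e / s).
  have x0 : 0 < x by rewrite lt_min ltr01/= divr_gt0.
  have x1 : x <= 1 by rewrite ge_min lexx.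
  have xe : x * s <= e by rewrite -ler_pdivlMr// ge_min lexx orbT.
  apply: le_trans (H _ x0) _.
  apply: (@le_trans _ _ ((1 + x * (2 ^+ n - 1)) * v)).
    by rewrite ler_wpM2r// bern// ltW.
  by move: xe; rewrite /s; nra.
rewrite -(fineK Vfin) -(fineK Ifin); congr EFin; apply/eqP; rewrite eq_le.
apply/andP; split; apply: lim1.
- exact: fine_ge0.
- by move=> x /key[+ _]; rewrite -{1}(fineK Vfin) -{1}(fineK Ifin) -EFinM lee_fin.
- by apply: fine_ge0; exact: measure_ge0.
- by move=> x /key[_]; rewrite -{1}(fineK Vfin) -{1}(fineK Ifin) -EFinM lee_fin.
Qed.

End Polar.

(** * Complex differentiability *)

Section Cabs.
Context {R : realType}.
Local Notation C := R[i].
Implicit Types z w h : C.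

(** The norm of [R[i]] takes its values in [R[i]]; this real-valued modulus allows estimates to be
    carried out in [R]. *)
Definition cabs z : R := Num.sqrt (complex.Re z ^+ 2 + complex.Im z ^+ 2).

Lemma cabsE z : `|z| = (cabs z)%:C.
Proof. exact: normc_def. Qed.

Lemma cabs_ge0 z : 0 <= cabs z.
Proof. exact: sqrtr_ge0. Qed.

Lemma cabsM z w : cabs (z * w) = cabs z * cabs w.
Proof. by apply: complexI; rewrite rmorphM/= -!cabsE normrM. Qed.

Lemma cabsD z w : cabs (z + w) <= cabs z + cabs w.
Proof. by rewrite -lecR rmorphD/= -!cabsE ler_normD. Qed.

Lemma cabsN z : cabs (- z) = cabs z.
Proof. by apply: complexI; rewrite -!cabsE normrN. Qed.

Lemma cabsB z w : cabs (z - w) <= cabs z + cabs w.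
Proof. by rewrite (le_trans (cabsD _ _))// cabsN. Qed.

Lemma cabsV z : cabs z^-1 = (cabs z)^-1.
Proof. by apply: complexI; rewrite fmorphV/= -!cabsE normfV. Qed.

Lemma cabs0 : cabs 0 = 0.
Proof. by apply: complexI; rewrite -cabsE normr0. Qed.

Lemma cabs1 : cabs 1 = 1.
Proof. by apply: complexI; rewrite -cabsE normr1. Qed.

Lemma cabs_gt0 z : (0 < cabs z) = (z != 0).
Proof. by rewrite -ltcR -cabsE normr_gt0. Qed.

Lemma cabs_real (x : R) : cabs x%:C = `|x|.
Proof. by rewrite /cabs/= expr0n addr0 sqrtr_sqr. Qed.

Lemma le_Re_cabs z : `|complex.Re z| <= cabs z.
Proof. by rewrite -sqrtr_sqr ler_wsqrtr// lerDl sqr_ge0. Qed.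

Lemma le_Im_cabs z : `|complex.Im z| <= cabs z.
Proof. by rewrite -sqrtr_sqr ler_wsqrtr// lerDr sqr_ge0. Qed.

Lemma le_cabs_ReIm z : cabs z <= `|complex.Re z| + `|complex.Im z|.
Proof.
rewrite -(@ger0_norm _ (_ + `|_|)) ?addr_ge0// -sqrtr_sqr ler_wsqrtr//.
rewrite -(real_normK (num_real (complex.Re z))) -(real_normK (num_real (complex.Im z))).
have := normr_ge0 (complex.Re z); have := normr_ge0 (complex.Im z).
by rewrite sqrrD; nra.
Qed.

End Cabs.

Section Cdiff.
Context {R : realType}.
Local Notation C := R[i].
Implicit Types (z w h l k : C) (f g : C -> C).

(* Differentiability with a quadratic remainder: stronger than having a
   derivative, but stable under the same operations with explicit bounds. *)
Definition cdiff f z l := exists (M d : R), 0 <= M /\ 0 < d /\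
  forall h, cabs h < d -> cabs (f (z + h) - f z - l * h) <= M * cabs h ^+ 2.

Lemma cdiff_lip f z l : cdiff f z l -> exists (K d : R), 0 <= K /\ 0 < d /\
  forall h, cabs h < d -> cabs (f (z + h) - f z) <= K * cabs h.
Proof.
move=> [M [d [M0 [d0 H]]]].
exists (M + cabs l), (Num.min d 1); split; first by rewrite addr_ge0// cabs_ge0.
split; first by rewrite lt_min d0/=.
move=> h; rewrite lt_min => /andP[hd h1].
have -> : f (z + h) - f z = (f (z + h) - f z - l * h) + l * h by ring.
apply: le_trans (cabsD _ _) _; rewrite mulrDl cabsM lerD2r.
apply: le_trans (H _ hd) _; rewrite ler_wpM2l// expr2.
by rewrite -[leRHS]mul1r ler_wpM2r// ?cabs_ge0// ltW.
Qed.

(** Dividing the quadratic remainder by [h] leaves an error of at most [M * cabs h]. *)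
Lemma cdiff_cvg f z l : cdiff f z l ->
  (fun h => (f (z + h) - f z) / h) @ 0^' --> l.
Proof.
move=> [M [d [M0 [d0 H]]]].
apply/cvg_ballP => e e0.
(* The radius [e] is a positive element of [R[i]], hence real. *)
have [e' e'0 ee'] : exists2 e' : R, 0 < e' & e'%:C = e.
  by case: e e0 => a b; rewrite ltcE/= => /andP[/eqP -> a0]; exists a.
pose d' := Num.min d (e' / (M + 1)).
have M1 : 0 < M + 1 by lra.
have d'0 : 0 < d' by rewrite lt_min d0/= divr_gt0.
rewrite /dnbhs /within/=.
exists d'%:C => /=; first by rewrite ltcR.
move=> h /=; rewrite /ball_/= sub0r normrN cabsE ltcR lt_min => /andP[hd he] h0.
rewrite /ball/= /ball_/= -ee' cabsE ltcR.
have hp : 0 < cabs h by rewrite cabs_gt0.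
have -> : l - (f (z + h) - f z) / h = - ((f (z + h) - f z - l * h) / h) by field.
rewrite cabsN cabsM cabsV ltr_pdivrMr//.
apply: le_lt_trans (H _ hd) _.
rewrite expr2 mulrA ltr_pM2r//; move: he; rewrite ltr_pdivlMr//.
by nra.
Qed.

Lemma cdiff_id z : cdiff id z 1.
Proof.
exists 0, 1; split=> //; split=> // h _.
by rewrite (_ : id (z + h) - id z - 1 * h = 0) ?cabs0 ?mul0r//=; ring.
Qed.

Lemma cdiff_cst c z : cdiff (fun=> c) z 0.
Proof.
by exists 0, 1; split=> //; split=> // h _; rewrite subrr mul0r subr0 cabs0 mul0r.
Qed.

Lemma cdiffD f g z l k : cdiff f z l -> cdiff g z k ->
  cdiff (fun w => f w + g w) z (l + k).
Proof.
move=> [M [d [M0 [d0 H]]]] [M' [d' [M'0 [d'0 H']]]].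
exists (M + M'), (Num.min d d'); split; first exact: addr_ge0.
split; first by rewrite lt_min d0.
move=> h; rewrite lt_min => /andP[hd hd'].
have -> : f (z + h) + g (z + h) - (f z + g z) - (l + k) * h =
  (f (z + h) - f z - l * h) + (g (z + h) - g z - k * h) by ring.
by rewrite [leRHS]mulrDl (le_trans (cabsD _ _))// lerD// (H, H').
Qed.

Lemma cdiffM f g z l k : cdiff f z l -> cdiff g z k ->
  cdiff (fun w => f w * g w) z (l * g z + f z * k).
Proof.
move=> df dg.
have [K [e [K0 [e0 lf]]]] := cdiff_lip df.
have [K' [e' [K'0 [e'0 lg]]]] := cdiff_lip dg.
move: df dg => [M [d [M0 [d0 H]]]] [M' [d' [M'0 [d'0 H']]]].
exists (K * K' + cabs (g z) * M + cabs (f z) * M'), (Num.min (Num.min d d') (Num.min e e')).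
split; first by rewrite !addr_ge0// mulr_ge0// cabs_ge0.
split; first by rewrite !lt_min d0 d'0 e0.
move=> h; rewrite !lt_min => /andP[/andP[hd hd'] /andP[he he']].
have -> : f (z + h) * g (z + h) - f z * g z - (l * g z + f z * k) * h =
  (f (z + h) - f z) * (g (z + h) - g z) + g z * (f (z + h) - f z - l * h)
  + f z * (g (z + h) - g z - k * h) by ring.
rewrite [leRHS]mulrDl [X in _ <= X + _]mulrDl (le_trans (cabsD _ _))// lerD//.
  rewrite (le_trans (cabsD _ _))// lerD//.
    by rewrite cabsM expr2 mulrACA ler_pM ?cabs_ge0 ?lf ?lg.
  by rewrite cabsM -mulrA ler_wpM2l ?cabs_ge0 ?H.
by rewrite cabsM -mulrA ler_wpM2l ?cabs_ge0 ?H'.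
Qed.

Lemma cdiffX n z : exists l, cdiff (fun w => w ^+ n) z l.
Proof.
elim: n => [|n [l IH]].
  by exists 0; under [X in cdiff X]eq_fun do rewrite expr0; exact: cdiff_cst.
eexists; under [X in cdiff X]eq_fun do rewrite exprS.
exact: cdiffM (cdiff_id z) IH.
Qed.

Lemma cdiffV z : z != 0 -> cdiff (fun w => w^-1) z (- z ^- 2).
Proof.
rewrite -cabs_gt0 => z0.
(* The remainder is exactly [h ^ 2 / (z ^ 2 (z + h))], and [|z + h| >= |z| / 2] on this disc. *)
exists (2 * cabs z ^- 3), (cabs z / 2).
split; first by rewrite mulr_ge0// invr_ge0 exprn_ge0// ltW.
split; first by rewrite divr_gt0.
move=> h hz.
have zh : cabs z / 2 <= cabs (z + h).
  have := cabsB (z + h) h; rewrite addrK; lra.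
have zh0 : 0 < cabs (z + h) by apply: lt_le_trans zh; rewrite divr_gt0.
have -> : (z + h)^-1 - z^-1 - - z ^- 2 * h = (h * h) / (z * z * (z + h)).
  by field; rewrite -!cabs_gt0 z0 zh0.
rewrite !cabsM cabsV !cabsM mulrC expr2 ler_wpM2r ?mulr_ge0 ?cabs_ge0//.
rewrite invfM (_ : 2 * cabs z ^- 3 = (cabs z * cabs z)^-1 * (cabs z / 2)^-1).
  by rewrite ler_wpM2l ?invr_ge0 ?mulr_ge0 ?cabs_ge0// lef_pV2// posrE divr_gt0.
by field; rewrite gt_eqF.
Qed.

Lemma cdiff_comp f g z l k : cdiff f z l -> cdiff g (f z) k ->
  cdiff (fun w => g (f w)) z (k * l).
Proof.
move=> df; have [K [e [K0 [e0 lf]]]] := cdiff_lip df.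
move: df => [M [d [M0 [d0 H]]]] [M' [d' [M'0 [d'0 H']]]].
have K1 : 0 < K + 1 by lra.
(* The Lipschitz bound on the inner increment turns the outer remainder into [M' K ^ 2 |h| ^ 2]; the
   divisor is [K + 1] because [K] may be 0. *)
exists (M' * K ^+ 2 + cabs k * M), (Num.min (Num.min d (d' / (K + 1))) e).
split; first by rewrite addr_ge0// mulr_ge0 ?cabs_ge0// exprn_ge0.
split; first by rewrite !lt_min d0 e0 divr_gt0.
move=> h; rewrite !lt_min => /andP[/andP[hd hd'] he].
set D := f (z + h) - f z.
have Dh : cabs D <= K * cabs h by exact: lf.
have -> : g (f (z + h)) - g (f z) - k * l * h =
  (g (f z + D) - g (f z) - k * D) + k * (f (z + h) - f z - l * h).
  by rewrite (_ : f z + D = f (z + h)) /D; ring.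
rewrite [leRHS]mulrDl (le_trans (cabsD _ _))// lerD//.
  apply: le_trans (H' _ _) _.
    apply: le_lt_trans Dh _; move: hd'; rewrite ltr_pdivlMr// => hd'.
    by apply: le_lt_trans hd'; have := cabs_ge0 h; nra.
  rewrite -mulrA ler_wpM2l// -exprMn lerXn2r// nnegrE ?cabs_ge0//.
  by rewrite mulr_ge0 ?cabs_ge0.
by rewrite cabsM -mulrA ler_wpM2l ?cabs_ge0 ?H.
Qed.

Lemma open_cabs_lt (rho : R) : open [set w : C | `|w| < rho%:C].
Proof.
rewrite openE => z; rewrite /= cabsE ltcR => zr; rewrite /interior.
apply/nbhs_ballP; exists (rho - cabs z)%:C => /=; first by rewrite ltcR subr_gt0.
move=> w; rewrite /ball/= /ball_/= !cabsE !ltcR => zw.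
have := cabsB z (z - w); rewrite (_ : z - (z - w) = w); last by ring.
by lra.
Qed.

Lemma open_cabs_gt (rho : R) : open [set w : C | rho%:C < `|w|].
Proof.
rewrite openE => z; rewrite /= cabsE ltcR => zr; rewrite /interior.
apply/nbhs_ballP; exists (cabs z - rho)%:C => /=; first by rewrite ltcR subr_gt0.
move=> w; rewrite /ball/= /ball_/= !cabsE !ltcR => zw.
have := cabsD w (z - w); rewrite (_ : w + (z - w) = z); last by ring.
by lra.
Qed.

End Cdiff.

(** * The complex square root near 1 *)

Section Csqrt.
Context {R : realType}.
Local Notation C := R[i].
Implicit Types z w h : C.

(** The real part of the principal square root. Since twice the product of the two parts of the root
    is [Im z], it determines the imaginary part in [csqrt]. *)
Definition csqrt_re z : R := Num.sqrt ((cabs z + complex.Re z) / 2).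
Definition csqrt z : C := csqrt_re z +i* (complex.Im z / (2 * csqrt_re z)).

Lemma csqrt_re_ge z : 1 / 2 <= complex.Re z -> 1 / 2 <= csqrt_re z.
Proof.
move=> z2; have := le_Re_cabs z; rewrite ger0_norm; last by lra.
move=> zz; rewrite /csqrt_re -[leLHS]ger0_norm; last by lra.
by rewrite -sqrtr_sqr ler_wsqrtr// expr2; lra.
Qed.

Lemma sqr_csqrt z : 1 / 2 <= complex.Re z -> csqrt z ^+ 2 = z.
Proof.
move=> z2; have s2 := csqrt_re_ge z2.
have s0 : csqrt_re z != 0 by rewrite gt_eqF//; lra.
have := le_Re_cabs z; rewrite ger0_norm; last by lra.
move=> zz.
have sE : csqrt_re z ^+ 2 = (cabs z + complex.Re z) / 2.
  by rewrite sqr_sqrtr//; lra.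
have zE : cabs z ^+ 2 = complex.Re z ^+ 2 + complex.Im z ^+ 2.
  by rewrite sqr_sqrtr// addr_ge0// sqr_ge0.
rewrite expr2 /csqrt; case: z z2 s2 s0 zz sE zE => a b /= z2 s2 s0 zz sE zE.
set s := csqrt_re _ in s2 s0 sE *; set c := cabs _ in zz sE zE *.
apply/eqP; rewrite eq_complex/=; apply/andP; split; apply/eqP; last by field.
have -> : b / (2 * s) * (b / (2 * s)) = b ^+ 2 / (4 * s ^+ 2) by field.
have ca : c + a != 0 by rewrite gt_eqF//; lra.
rewrite -expr2 sE (_ : b ^+ 2 = c ^+ 2 - a ^+ 2); last by rewrite zE; ring.
by field.
Qed.

Lemma csqrt_real (x : R) : 0 < x -> csqrt x%:C = (Num.sqrt x)%:C.
Proof.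
move=> x0; rewrite /csqrt /csqrt_re cabs_real gtr0_norm//= mul0r.
by rewrite (_ : (x + x) / 2 = x)//; field.
Qed.

Lemma cabs_csqrt z : 1 / 2 <= complex.Re z -> cabs z <= 4 -> cabs (csqrt z) <= 2.
Proof.
move=> z2; rewrite -{1}(sqr_csqrt z2) expr2 cabsM => H.
by have := cabs_ge0 (csqrt z); nra.
Qed.

Lemma Re_ge_half z : cabs (z - 1) <= 1 / 2 -> 1 / 2 <= complex.Re z.
Proof.
move=> H; have := le_trans (le_Re_cabs (z - 1)) H.
by case: z {H} => a b /=; rewrite ler_norml => /andP[+ _]; lra.
Qed.

(** Both roots have real part at least 1/2. This bounds the denominator away from 0 when a
    difference of roots is rationalised. *)
Lemma cabs_csqrtD z w : 1 / 2 <= complex.Re z -> 1 / 2 <= complex.Re w ->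
  1 <= cabs (csqrt z + csqrt w).
Proof.
move=> /csqrt_re_ge zs /csqrt_re_ge ws; apply: le_trans (le_Re_cabs _) => /=.
by rewrite ger0_norm; lra.
Qed.

End Csqrt.

(** * Differentiability uniform in a second variable *)

Section UniformlyDiff.
Context {R : realType} {T : Type}.
Local Notation C := R[i].
Variable rho : R.
Hypothesis rho2 : rho <= 1 / 2.
Implicit Types F D : C -> T -> C.

(* The remainder bound is uniform in [y], so it survives integration over [y]. *)
Definition ud F D := exists M : R, 0 <= M /\ forall w y, cabs w < rho ->
  [/\ cabs (F w y) <= M, cabs (D w y) <= M &
  forall h, cabs (w + h) < rho ->
    cabs (F (w + h) y - F w y - D w y * h) <= M * cabs h ^+ 2].

(** Two points of a disc of radius at most 1/2 are at distance at most 1, which lets a power of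
    [cabs h] be absorbed into a constant. *)
Lemma ud_step w (h : C) : cabs w < rho -> cabs (w + h) < rho -> cabs h <= 1.
Proof.
by move: rho2 => r2 w1 w2; have := cabsB (w + h) w; rewrite (_ : w + h - w = h); [lra|ring].
Qed.

Lemma ud_id (t : T -> C) (B : R) : 0 <= B -> (forall y, cabs (t y) <= B) ->
  ud (fun w y => w * t y) (fun _ y => t y).
Proof.
move=> B0 tB; exists B; split => // w y wr; split => //.
  by rewrite cabsM -[leRHS]mul1r ler_pM ?cabs_ge0//; move: rho2; lra.
move=> h _; rewrite (_ : _ - _ - _ = 0) ?cabs0; last by ring.
by rewrite mulr_ge0// exprn_ge0// cabs_ge0.
Qed.

Lemma ud_cst (c : C) : ud (fun _ _ => c) (fun _ _ => 0).
Proof.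
exists (cabs c); split; first exact: cabs_ge0.
move=> w y wr; split; rewrite ?cabs0 ?cabs_ge0// => h _.
by rewrite subrr mul0r subrr cabs0 mulr_ge0 ?exprn_ge0 ?cabs_ge0.
Qed.

Lemma udD F D G E : ud F D -> ud G E ->
  ud (fun w y => F w y + G w y) (fun w y => D w y + E w y).
Proof.
move=> [M [M0 HF]] [N [N0 HG]]; exists (M + N); split; first exact: addr_ge0.
move=> w y wr; have [F1 D1 FD] := HF w y wr; have [G1 E1 GE] := HG w y wr.
split; [by rewrite (le_trans (cabsD _ _))// lerD..|] => h hr.
rewrite (_ : _ - _ - _ = (F (w + h) y - F w y - D w y * h) +
  (G (w + h) y - G w y - E w y * h)); last by ring.
by rewrite [leRHS]mulrDl (le_trans (cabsD _ _))// lerD ?FD ?GE.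
Qed.

Lemma udM F D G E : ud F D -> ud G E ->
  ud (fun w y => F w y * G w y) (fun w y => D w y * G w y + F w y * E w y).
Proof.
(* The Lipschitz bounds [2 M |h|] and [2 N |h|] make the product of the increments cost
   [4 M N |h| ^ 2]; the two remainders cost [M N |h| ^ 2] each. *)
move=> [M [M0 HF]] [N [N0 HG]]; exists (6 * M * N).
split; first by rewrite !mulr_ge0.
have MN : 0 <= M * N by exact: mulr_ge0.
move=> w y wr; have [F1 D1 FD] := HF w y wr; have [G1 E1 GE] := HG w y wr.
have pr (a b : C) : cabs a <= M -> cabs b <= N -> cabs (a * b) <= M * N.
  by move=> aM bN; rewrite cabsM ler_pM ?cabs_ge0.
split.
- by apply: le_trans (pr _ _ F1 G1) _; rewrite -mulrA; nra.
- apply: le_trans (cabsD _ _) _; have := pr _ _ D1 G1; have := pr _ _ F1 E1.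
  by rewrite -mulrA; lra.
move=> h hr; have h1 := ud_step wr hr; have h0 := cabs_ge0 h.
have {}FD := FD h hr; have {}GE := GE h hr.
have lip (a b d : C) (K : R) : 0 <= K -> cabs d <= K ->
    cabs (a - b - d * h) <= K * cabs h ^+ 2 -> cabs (a - b) <= 2 * K * cabs h.
  move=> K0 dK H; rewrite (_ : a - b = (a - b - d * h) + d * h); last by ring.
  apply: le_trans (cabsD _ _) _; rewrite cabsM.
  have : K * cabs h ^+ 2 <= K * cabs h.
    by rewrite ler_wpM2l// expr2 -[leRHS]mul1r ler_wpM2r.
  have : cabs d * cabs h <= K * cabs h by rewrite ler_wpM2r.
  by lra.
have lF := lip _ _ _ _ M0 D1 FD; have lG := lip _ _ _ _ N0 E1 GE.
rewrite (_ : _ - _ - _ = (F (w + h) y - F w y) * (G (w + h) y - G w y)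
  + ((F (w + h) y - F w y - D w y * h) * G w y
  + F w y * (G (w + h) y - G w y - E w y * h))); last by ring.
have b1 : cabs ((F (w + h) y - F w y) * (G (w + h) y - G w y)) <= 4 * (M * N) * cabs h ^+ 2.
  rewrite cabsM (_ : 4 * (M * N) * cabs h ^+ 2 =
      (2 * M * cabs h) * (2 * N * cabs h)); last by ring.
  by rewrite ler_pM ?cabs_ge0.
have b2 : cabs ((F (w + h) y - F w y - D w y * h) * G w y) <= M * N * cabs h ^+ 2.
  by rewrite cabsM mulrAC ler_pM ?cabs_ge0.
have b3 : cabs (F w y * (G (w + h) y - G w y - E w y * h)) <= M * N * cabs h ^+ 2.
  by rewrite cabsM -mulrA ler_pM ?cabs_ge0.
have := cabsD ((F (w + h) y - F w y - D w y * h) * G w y)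
  (F w y * (G (w + h) y - G w y - E w y * h)).
by move=> H; apply: le_trans (cabsD _ _) _; rewrite -!mulrA; lra.
Qed.

(** The radicand stays within 1/2 of 1, so the roots have modulus between 1/2 and 2, and their
    difference is the difference of the radicands over their sum. *)
Lemma ud_csqrt (q : T -> R) (Q : R) : (forall y, `|q y| <= Q) -> rho ^+ 2 * Q <= 1 / 2 ->
  ud (fun w y => csqrt (1 - w ^+ 2 * (q y)%:C))
     (fun w y => - (w * (q y)%:C / csqrt (1 - w ^+ 2 * (q y)%:C))).
Proof.
move=> qQ rQ.
have near1 w y : cabs w < rho -> cabs ((1 - w ^+ 2 * (q y)%:C) - 1) <= 1 / 2.
  move=> wr; rewrite (_ : _ - 1 = - (w ^+ 2 * (q y)%:C)); last by ring.
  rewrite cabsN expr2 !cabsM cabs_real; apply: le_trans rQ.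
  by rewrite expr2 !ler_pM ?mulr_ge0 ?cabs_ge0// ltW.
have big z : cabs (z - 1 : C) <= 1 / 2 -> cabs z <= 4.
  by move=> z1; have := cabsD (z - 1) 1; rewrite subrK cabs1; lra.
(* This equals [(4 Q + 1) ^ 2 + 1], hence is nonnegative even if [T] is empty and the sign of [Q]
   unknown. The summand [2] bounds the root; the others dominate the derivative and the
   remainder. *)
exists (8 * Q + 16 * Q ^+ 2 + 2).
have Q0 (y : T) : 0 <= Q by exact: le_trans (normr_ge0 _) (qQ y).
split; first by have := sqr_ge0 (4 * Q + 1); rewrite !expr2; clear Q0; lra.
move=> w y wr; have {}Q0 := Q0 y.
have cq : cabs (q y)%:C <= Q by rewrite cabs_real.
have z1 := near1 w y wr; have z2 := Re_ge_half z1.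
set z := 1 - _ in z1 z2 *; set s := csqrt z.
have ss : 1 / 2 <= cabs s by have := cabs_csqrtD z2 z2; have := cabsD s s; rewrite -/s; lra.
have s0 : s != 0 by rewrite -cabs_gt0; lra.
have s2 : cabs s <= 2 by apply: cabs_csqrt => //; exact: big.
have w1 : cabs w <= 1 / 2 by move: rho2; lra.
have w0 := cabs_ge0 w.
have is2 : (cabs s)^-1 <= 2.
  by rewrite -[2]invrK lef_pV2 ?posrE//; lra.
split.
- by have := mulr_ge0 Q0 Q0; rewrite expr2; lra.
- rewrite cabsN !cabsM cabsV.
  have : cabs w * cabs (q y)%:C * (cabs s)^-1 <= 1 / 2 * Q * 2.
    by rewrite !ler_pM ?mulr_ge0 ?invr_ge0 ?cabs_ge0.
  by have := mulr_ge0 Q0 Q0; rewrite expr2; lra.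
move=> h hr; have h1 := ud_step wr hr; have h0 := cabs_ge0 h.
have z1' := near1 _ y hr; have z2' := Re_ge_half z1'.
set z' := 1 - (w + h) ^+ 2 * _ in z1' z2' *; set s' := csqrt z'.
have sE : s ^+ 2 = z by exact: sqr_csqrt.
have s'E : s' ^+ 2 = z' by exact: sqr_csqrt.
have S1 : 1 <= cabs (s' + s) by exact: cabs_csqrtD.
have S0 : s' + s != 0 by rewrite -cabs_gt0; lra.
have ds : s' - s = - ((2 * w + h) * h * (q y)%:C) / (s' + s).
  apply: (mulIf S0); rewrite divfK// (_ : (s' - s) * (s' + s) = s' ^+ 2 - s ^+ 2); last by ring.
  by rewrite sE s'E /z /z'; ring.
have dsb : cabs (s' - s) <= 2 * Q * cabs h.
  rewrite ds cabsM cabsV cabsN !cabsM.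
  have i1 : (cabs (s' + s))^-1 <= 1 by rewrite invf_le1//; lra.
  have b : cabs (2 * w + h) <= 2.
    apply: le_trans (cabsD _ _) _; rewrite cabsM.
    rewrite (_ : 2 = 2%:R%:C); last by rewrite rmorph_nat.
    by rewrite cabs_real normr_nat; lra.
  rewrite -[leRHS]mulr1 ler_pM ?mulr_ge0 ?invr_ge0 ?cabs_ge0//.
  rewrite (_ : 2 * Q * cabs h = 2 * cabs h * Q); last by ring.
  by rewrite !ler_pM ?mulr_ge0 ?cabs_ge0.
(* Both terms of this numerator are quadratic in [h], the second because [s' - s] is itself of order
   [h] by [dsb]. *)
have -> : s' - s - - (w * (q y)%:C / s) * h =
    (- (h ^+ 2 * (q y)%:C * s) + w * (q y)%:C * h * (s' - s)) * (s^-1 * (s' + s)^-1).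
  rewrite {1}ds; apply: (mulIf S0); apply: (mulIf s0).
  by field; rewrite s0 S0.
rewrite cabsM cabsM !cabsV.
have i1 : (cabs s)^-1 * (cabs (s' + s))^-1 <= 2 * 1.
  by rewrite ler_pM ?invr_ge0 ?cabs_ge0// invf_le1//; lra.
have n1 : cabs (- (h ^+ 2 * (q y)%:C * s)) <= cabs h ^+ 2 * Q * 2.
  by rewrite cabsN expr2 !cabsM -expr2 !ler_pM ?mulr_ge0 ?exprn_ge0 ?cabs_ge0.
have n2 : cabs (w * (q y)%:C * h * (s' - s)) <= 1 / 2 * Q * cabs h * (2 * Q * cabs h).
  by rewrite !cabsM !ler_pM ?mulr_ge0 ?cabs_ge0.
apply: (@le_trans _ _ ((cabs h ^+ 2 * Q * 2 +
    1 / 2 * Q * cabs h * (2 * Q * cabs h)) * (2 * 1))).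
  rewrite ler_pM ?mulr_ge0 ?invr_ge0 ?cabs_ge0//.
  by apply: le_trans (cabsD _ _) _; rewrite lerD.
have : 0 <= cabs h ^+ 2 by rewrite exprn_ge0.
have : 0 <= Q * cabs h ^+ 2 by rewrite mulr_ge0// exprn_ge0.
have : 0 <= Q * Q * cabs h ^+ 2 by rewrite !mulr_ge0// exprn_ge0.
by rewrite !expr2; lra.
Qed.

End UniformlyDiff.

(** * Integrals depending on a complex parameter *)

Section ComplexIntegral.
Context {R : realType} d (T : measurableType d).
Local Notation C := R[i].
Implicit Types f g : T -> C.

(** The parts of a remainder are written in the shape that [Rintegral_lin4] integrates: a difference
    plus two terms with a constant right factor. *)
Lemma Re_lin (a b c h : C) : complex.Re (a - b - c * h) =
  complex.Re a - complex.Re b +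
  (complex.Re c * - complex.Re h + complex.Im c * complex.Im h).
Proof. by case: a b c h => [? ?] [? ?] [? ?] [? ?] /=; ring. Qed.

Lemma Im_lin (a b c h : C) : complex.Im (a - b - c * h) =
  complex.Im a - complex.Im b +
  (complex.Re c * - complex.Im h + complex.Im c * - complex.Re h).
Proof. by case: a b c h => [? ?] [? ?] [? ?] [? ?] /=; ring. Qed.

Definition cmeas f := measurable_fun setT (fun y => complex.Re (f y)) /\
  measurable_fun setT (fun y => complex.Im (f y)).

Lemma cmeas_cst (c : C) : cmeas (fun=> c).
Proof. by split; exact: measurable_cst. Qed.

Lemma cmeas_real (f : T -> R) : measurable_fun setT f -> cmeas (fun y => (f y)%:C).
Proof. by move=> mf; split => //=; exact: measurable_cst. Qed.

Lemma cmeasD f g : cmeas f -> cmeas g -> cmeas (fun y => f y + g y).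
Proof.
move=> [f1 f2] [g1 g2]; split.
  rewrite (_ : (fun y => _) = (fun y => complex.Re (f y)) \+ (fun y => complex.Re (g y))).
    exact: measurable_funD.
  by apply/funext => y /=; case: (f y) => ? ?; case: (g y).
rewrite (_ : (fun y => _) = (fun y => complex.Im (f y)) \+ (fun y => complex.Im (g y))).
  exact: measurable_funD.
by apply/funext => y /=; case: (f y) => ? ?; case: (g y).
Qed.

Lemma cmeasM f g : cmeas f -> cmeas g -> cmeas (fun y => f y * g y).
Proof.
move=> [f1 f2] [g1 g2]; split.
  rewrite (_ : (fun y => _) = (fun y => complex.Re (f y) * complex.Re (g y)
     - complex.Im (f y) * complex.Im (g y))).
    by apply: measurable_funB; exact: measurable_funM.
  by apply/funext => y /=; case: (f y) => ? ?; case: (g y).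
rewrite (_ : (fun y => _) = (fun y => complex.Re (f y) * complex.Im (g y)
     + complex.Im (f y) * complex.Re (g y))).
  by apply: measurable_funD; exact: measurable_funM.
by apply/funext => y /=; case: (f y) => ? ?; case: (g y).
Qed.

Lemma cmeasN f : cmeas f -> cmeas (fun y => - f y).
Proof.
move=> mf; rewrite (_ : (fun y => _) = (fun y => (-1) * f y)).
  by apply: cmeasM => //; exact: cmeas_cst.
by apply/funext => y; rewrite mulN1r.
Qed.

Lemma cmeasX f n : cmeas f -> cmeas (fun y => f y ^+ n).
Proof.
move=> mf; elim: n => [|n IH].
  by under [X in cmeas X]eq_fun do rewrite expr0; exact: cmeas_cst.
by under [X in cmeas X]eq_fun do rewrite exprS; exact: cmeasM.
Qed.

Lemma cmeasV f : cmeas f -> cmeas (fun y => (f y)^-1).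
Proof.
move=> [f1 f2].
have mN : measurable_fun setT
    (fun y => (complex.Re (f y) ^+ 2 + complex.Im (f y) ^+ 2)^-1).
  by apply: measurable_funV; apply: measurable_funD; exact: measurable_funX.
split.
  rewrite (_ : (fun y => _) = (fun y => complex.Re (f y) *
    (complex.Re (f y) ^+ 2 + complex.Im (f y) ^+ 2)^-1)); first exact: measurable_funM.
  by apply/funext => y /=; case: (f y).
rewrite (_ : (fun y => _) = (fun y => - (complex.Im (f y) *
    (complex.Re (f y) ^+ 2 + complex.Im (f y) ^+ 2)^-1))).
  by apply: measurable_funN; exact: measurable_funM.
by apply/funext => y /=; case: (f y) => a b /=; rewrite -mulNr.
Qed.

Lemma cmeas_csqrt f : cmeas f -> cmeas (fun y => csqrt (f y)).
Proof.
move=> [f1 f2].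
have mr : measurable_fun setT (fun y => csqrt_re (f y)).
  apply: (measurableT_comp measurable_sqrt); apply: measurable_funM => //.
  apply: measurable_funD => //; apply: (measurableT_comp measurable_sqrt).
  by apply: measurable_funD; exact: measurable_funX.
split => //=; apply: measurable_funM => //; apply: measurable_funV.
exact: measurable_funM.
Qed.

Variables (mu : {measure set T -> \bar R}) (B : set T).
Hypotheses (mB : measurable B) (muB : (mu B < +oo)%E).

Definition cint f : C :=
  (\int[mu]_(y in B) complex.Re (f y)) +i* (\int[mu]_(y in B) complex.Im (f y)).

Lemma integrable_bounded (f : T -> R) (M : R) : measurable_fun setT f ->
  (forall y, `|f y| <= M) -> mu.-integrable B (EFin \o f).
Proof.
move=> mf fM; apply: measurable_bounded_integrable => //.
  exact: measurable_funS mf.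
exists M; split; first exact: num_real.
by move=> x Mx y _ /=; apply: le_trans (fM y) (ltW Mx).
Qed.

Lemma Rintegral_bounded (f : T -> R) (M : R) : measurable_fun setT f ->
  (forall y, `|f y| <= M) -> `|\int[mu]_(y in B) f y| <= M * fine (mu B).
Proof.
move=> mf fM; have fi := integrable_bounded mf fM.
apply: le_trans (le_normr_Rintegral _ fi) _ => //.
rewrite -Rintegral_cst//; apply: le_Rintegral => //.
  apply: (@integrable_bounded _ M) => [|y]; last by rewrite normr_id.
  exact: measurableT_comp.
by apply: (@integrable_bounded _ `|M|).
Qed.

Lemma Rintegral_lin4 (f g u v : T -> R) (a b : R) :
  mu.-integrable B (EFin \o f) -> mu.-integrable B (EFin \o g) ->
  mu.-integrable B (EFin \o u) -> mu.-integrable B (EFin \o v) ->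
  \int[mu]_(y in B) (f y - g y + (u y * a + v y * b)) =
  \int[mu]_(y in B) f y - \int[mu]_(y in B) g y
  + (\int[mu]_(y in B) u y * a + \int[mu]_(y in B) v y * b).
Proof.
move=> fi gi ui vi.
have fgi : mu.-integrable B (EFin \o (fun y => f y - g y)).
  by rewrite (_ : _ \o _ = (EFin \o f) \- (EFin \o g))%E//; exact: integrableB.
have Zi (w : T -> R) (c : R) : mu.-integrable B (EFin \o w) ->
    mu.-integrable B (EFin \o (fun y => w y * c)).
  move=> wi; rewrite (_ : _ \o _ = (fun y => (EFin \o w) y * c%:E))%E//.
  exact: integrableZr.
have uvi : mu.-integrable B (EFin \o (fun y => u y * a + v y * b)).
  rewrite (_ : _ \o _ = (EFin \o (fun y => u y * a)%R) \+ (EFin \o (fun y => v y * b)%R))%E//.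
  by apply: integrableD => //; exact: Zi.
rewrite RintegralD// RintegralB// RintegralD//; [|exact: Zi..].
by rewrite !RintegralZr.
Qed.

(** The remainder of the integral is the integral of the remainder, whose real and imaginary parts
    are each at most [M |h| ^ 2] times the mass of [B]; hence the factor 2. *)
Lemma cint_cdiff (F D : C -> T -> C) (rho : R) (w : C) :
  (forall w, cabs w < rho -> cmeas (F w)) ->
  (forall w, cabs w < rho -> cmeas (D w)) ->
  ud rho F D -> cabs w < rho -> cdiff (fun w => cint (F w)) w (cint (D w)).
Proof.
move=> mF mD [M [M0 H]] wr.
exists (2 * M * fine (mu B)), (rho - cabs w).
have muB0 : 0 <= fine (mu B) by rewrite fine_ge0.
split; first by rewrite !mulr_ge0.
split; first by rewrite subr_gt0.
move=> h hr; have whr : cabs (w + h) < rho by apply: le_lt_trans (cabsD _ _) _; lra.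
have [mF1 mF2] := mF _ whr; have [mf1 mf2] := mF _ wr; have [md1 md2] := mD _ wr.
have bR (f : T -> C) (K : R) : (forall y, cabs (f y) <= K) ->
    forall y, `|complex.Re (f y)| <= K.
  by move=> fK y; exact: le_trans (le_Re_cabs _) (fK y).
have bI (f : T -> C) (K : R) : (forall y, cabs (f y) <= K) ->
    forall y, `|complex.Im (f y)| <= K.
  by move=> fK y; exact: le_trans (le_Im_cabs _) (fK y).
have bF1 y : cabs (F (w + h) y) <= M by have [] := H _ y whr.
have bF2 y : cabs (F w y) <= M by have [] := H _ y wr.
have bD y : cabs (D w y) <= M by have [] := H _ y wr.
have iF1 := integrable_bounded mF1 (bR _ _ bF1).
have iF2 := integrable_bounded mF2 (bI _ _ bF1).
have if1 := integrable_bounded mf1 (bR _ _ bF2).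
have if2 := integrable_bounded mf2 (bI _ _ bF2).
have id1 := integrable_bounded md1 (bR _ _ bD).
have id2 := integrable_bounded md2 (bI _ _ bD).
pose G y := F (w + h) y - F w y - D w y * h.
have mG : cmeas G.
  apply: cmeasD; first by apply: cmeasD; [exact: mF|apply/cmeasN/mF].
  by apply: cmeasN; apply: cmeasM; [exact: mD|exact: cmeas_cst].
have bG y : cabs (G y) <= M * cabs h ^+ 2 by have [_ _] := H _ y wr; exact.
have GE : cint (F (w + h)) - cint (F w) - cint (D w) * h = cint G.
  have ReG y : complex.Re (G y) = complex.Re (F (w + h) y) - complex.Re (F w y) +
      (complex.Re (D w y) * - complex.Re h + complex.Im (D w y) * complex.Im h).
    exact: Re_lin.
  have ImG y : complex.Im (G y) = complex.Im (F (w + h) y) - complex.Im (F w y) +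
      (complex.Re (D w y) * - complex.Im h + complex.Im (D w y) * - complex.Re h).
    exact: Im_lin.
  rewrite /cint; under [in RHS]eq_Rintegral do rewrite ReG.
  under [X in _ = _ +i* X]eq_Rintegral do rewrite ImG.
  rewrite !Rintegral_lin4//.
  apply/eqP; rewrite eq_complex /=; case: (h) => a b /=.
  by apply/andP; split; apply/eqP; ring.
rewrite GE; apply: le_trans (le_cabs_ReIm _) _ => /=.
have := Rintegral_bounded mG.1 (bR _ _ bG).
have := Rintegral_bounded mG.2 (bI _ _ bG).
lra.
Qed.

End ComplexIntegral.

(** * Volumes of balls cut by cones and polyhedra *)

Section Laurent.
Context {R : realType} (n : nat).
Local Notation C := R[i].

(** At most a pole of order [n] at infinity. The condition [h 0 != 0] is left to the end, because
    linear combinations do not preserve it. *)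
Definition laurent (V : R -> R) := exists (rho : R) (h : C -> C), 0 < rho /\
  (forall w, cabs w < rho -> exists l, cdiff h w l) /\
  forall r, rho^-1 < r -> (V r)%:C = h (r^-1)%:C * r%:C ^+ n.

Lemma laurent0 : laurent (fun=> 0).
Proof.
exists 1, (fun=> 0); split => //; split.
  by move=> w _; exists 0; exact: cdiff_cst.
by move=> r _; rewrite mul0r.
Qed.

Lemma laurent_lin (c : R) U V : laurent U -> laurent V ->
  laurent (fun r => U r + c * V r).
Proof.
move=> [p [f [p0 [df fE]]]] [q [g [q0 [dg gE]]]].
exists (Num.min p q), (fun w => f w + c%:C * g w); split; first by rewrite lt_min p0.
split.
  move=> w; rewrite lt_min => /andP[/df[l dl] /dg[k dk]].
  by eexists; apply: cdiffD dl _; exact: cdiffM (cdiff_cst _ _) dk.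
move=> r pqr.
have pr : p^-1 < r.
  apply: le_lt_trans pqr; rewrite lef_pV2 ?posrE ?lt_min ?p0//.
  by rewrite ge_min lexx.
have qr : q^-1 < r.
  apply: le_lt_trans pqr; rewrite lef_pV2 ?posrE ?lt_min ?p0//.
  by rewrite ge_min lexx orbT.
by rewrite rmorphD rmorphM/= fE// gE//; ring.
Qed.

Lemma laurent_sum (I : Type) (s : seq I) (V : I -> R -> R) :
  (forall i, laurent (V i)) -> laurent (fun r => \sum_(i <- s) V i r).
Proof.
move=> HV; elim: s => [|i s IH].
  by under [X in laurent X]eq_fun do rewrite big_nil; exact: laurent0.
under [X in laurent X]eq_fun do rewrite big_cons -[X in _ + X]mul1r.
exact: laurent_lin.
Qed.

Lemma eq_laurent U V (r0 : R) : laurent U -> (forall r, r0 < r -> U r = V r) -> laurent V.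
Proof.
move=> [p [f [p0 [df fE]]]] UV.
have r1 : 0 < `|r0| + 1 by rewrite ltr_wpDl.
exists (Num.min p (`|r0| + 1)^-1), f; split; first by rewrite lt_min p0 invr_gt0.
split; first by move=> w; rewrite lt_min => /andP[/df].
move=> r pr.
have ir : `|r0| + 1 < r.
  apply: le_lt_trans pr; rewrite -[leLHS]invrK lef_pV2 ?posrE ?lt_min ?p0 ?invr_gt0//.
  by rewrite ge_min lexx orbT.
rewrite -UV; last by have := ler_norm r0; lra.
rewrite fE//; apply: le_lt_trans pr; rewrite lef_pV2 ?posrE ?lt_min ?p0 ?invr_gt0//.
by rewrite ge_min lexx.
Qed.

End Laurent.

(** * Balls cut by a cone *)

Section Cone.
Context {R : realType} (n : nat).
Local Notation C := R[i].
Variables (K : set 'rV[R]_n) (p : 'rV[R]_n).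

(* At [y = 0] the value is [0 / 0 = 0], so [slope] is homogeneous of degree [0]
   everywhere. *)
Definition slope y : R := dot p y / enorm y.

Lemma slope_homog (c : R) y : 0 < c -> slope (c *: y) = slope y.
Proof.
move=> c0; rewrite /slope dotZr (enormZ _ (ltW c0)) -mulf_div divff ?mul1r//.
by rewrite gt_eqF.
Qed.

Lemma slope_le y : `|slope y| <= \sum_i `|p ord0 i|.
Proof.
rewrite /slope normrM normfV (ger0_norm (enorm_ge0 _)).
have [->|y0] := eqVneq (enorm y) 0.
  by rewrite invr0 mulr0 sumr_ge0.
rewrite ler_pdivrMr; first exact: le_dot_enorm.
by rewrite lt_neqAle eq_sym y0 enorm_ge0.
Qed.

Lemma slopeK y : slope y * enorm y = dot p y.
Proof.
rewrite /slope; have [y0|y0] := eqVneq (enorm y) 0; last by rewrite divfK.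
rewrite y0 mulr0; apply/esym/eqP; rewrite -normr_le0.
by apply: le_trans (le_dot_enorm _ _) _; rewrite y0 mulr0.
Qed.

Lemma measurable_slope : measurable_fun setT slope.
Proof.
apply: measurable_funM; first exact: measurable_dot.
by apply: measurable_funV; exact: measurable_enorm.
Qed.

(* Distance from [0] to the unit sphere centred at [w p] in the direction [y]. *)
Definition radius (w : R) y : R :=
  w * slope y + Num.sqrt (1 - w ^+ 2 * (dot p p - slope y ^+ 2)).

(** With [e = |y|] and [t = slope y], the right side says [(e - w t) ^ 2 <= X]. The lower bound
    [- sqrt X <= e - w t] is automatic, as [e - w t >= -1/4] and [sqrt X >= 1/2], so only the upper
    one remains. *)
Lemma radiusP (w : R) y : `|w * slope y| <= 1 / 4 ->
  1 / 2 <= 1 - w ^+ 2 * (dot p p - slope y ^+ 2) ->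
  (enorm y <= radius w y) =
  (dot y y - 2 * w * dot p y + w ^+ 2 * dot p p <= 1).
Proof.
rewrite /radius -(sqr_enorm y) -(slopeK y); set t := slope y.
set e := enorm y; set X := 1 - _.
move=> wt X2; have e0 : 0 <= e := enorm_ge0 y.
have s2 : 1 / 2 <= Num.sqrt X.
  rewrite -[leLHS]ger0_norm; last by lra.
  by rewrite -sqrtr_sqr ler_wsqrtr// expr2; lra.
have sX : Num.sqrt X ^+ 2 = X by rewrite sqr_sqrtr//; lra.
have -> : (e ^+ 2 - 2 * w * (t * e) + w ^+ 2 * dot p p <= 1) =
    ((e - w * t) ^+ 2 <= Num.sqrt X ^+ 2).
  by rewrite sX /X; apply/idP/idP; rewrite !expr2; lra.
rewrite -[LHS]lerBlDl; move: wt; rewrite ler_norml => /andP[wt1 wt2].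
apply/idP/idP => H; last first.
  have : `|e - w * t| <= `|Num.sqrt X| by rewrite -ler_sqr ?nnegrE// !real_normK ?num_real.
  rewrite (ger0_norm (sqrtr_ge0 _)); exact: le_trans (ler_norm _).
rewrite -[leLHS]real_normK ?num_real// lerXn2r ?nnegrE ?sqrtr_ge0//.
by rewrite ler_norml H andbT; lra.
Qed.

Hypotheses (coneK : cone K) (mK : measurable K).

Lemma laurent_cone : laurent n (fun r => fine (vol (cball p r `&` K))).
Proof.
pose S := \sum_i `|p ord0 i|; pose Q := dot p p + S ^+ 2.
have S0 : 0 <= S by exact: sumr_ge0.
have Q0 : 0 <= Q by rewrite addr_ge0 ?dot_ge0 ?sqr_ge0.
(* This makes each of [rho], [rho S] and [rho Q] at most 1/4, which supplies all the smallness
   conditions below. *)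
pose rho := (4 * (1 + S + Q))^-1.
have d0 : 0 < 4 * (1 + S + Q) by lra.
have rho0 : 0 < rho by rewrite invr_gt0.
have rho1 : rho * (4 * (1 + S + Q)) = 1 by rewrite mulVf// gt_eqF.
have rS : 0 <= rho * S by rewrite mulr_ge0// ltW.
have rQ : 0 <= rho * Q by rewrite mulr_ge0// ltW.
have rho2 : rho <= 1 / 2 by lra.
pose q y := dot p p - slope y ^+ 2.
have qQ y : `|q y| <= Q.
  apply: le_trans (ler_normB _ _) _; rewrite (ger0_norm (dot_ge0 _)) lerD2l.
  by rewrite normrX lerXn2r ?nnegrE// slope_le.
have rQ2 : rho ^+ 2 * Q <= 1 / 2.
  by rewrite expr2 -mulrA; have := ler_wpM2r rQ rho2; lra.
(* [F1] extends [radius] to complex [w], and [D1] is its derivative in [w]. *)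
pose F1 (w : C) y := w * (slope y)%:C + csqrt (1 - w ^+ 2 * (q y)%:C).
pose D1 (w : C) y := (slope y)%:C + - (w * (q y)%:C / csqrt (1 - w ^+ 2 * (q y)%:C)).
have udF1 : ud rho F1 D1.
  apply: udD; last exact: ud_csqrt qQ rQ2.
  by apply: (@ud_id _ _ _ rho2 _ S) => // y; rewrite cabs_real slope_le.
have mq : measurable_fun setT q.
  by apply: measurable_funB => //; apply: measurable_funX; exact: measurable_slope.
have ms := measurable_slope.
have mz (w : C) : cmeas (fun y => csqrt (1 - w ^+ 2 * (q y)%:C)).
  apply: cmeas_csqrt; apply: cmeasD; first exact: cmeas_cst.
  by apply: cmeasN; apply: cmeasM; [exact: cmeas_cst|exact: cmeas_real].
have mF1 w : cmeas (F1 w).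
  by apply: cmeasD => //; apply: cmeasM; [exact: cmeas_cst|exact: cmeas_real].
have mD1 w : cmeas (D1 w).
  apply: cmeasD; first exact: cmeas_real.
  apply: cmeasN; apply: cmeasM; last exact: cmeasV.
  by apply: cmeasM; [exact: cmeas_cst|exact: cmeas_real].
have udFm (m : nat) : exists D, (forall w, cmeas (D w)) /\
    ud rho (fun w y => F1 w y ^+ m) D.
  elim: m => [|m [D [mD IH]]].
    by exists (fun _ _ => 0); split; [move=> w; exact: cmeas_cst|exact: ud_cst].
  exists (fun w y => D1 w y * F1 w y ^+ m + F1 w y * D w y); split.
    by move=> w; apply: cmeasD; apply: cmeasM => //; exact: cmeasX.
  by under [X in ud _ X]eq_fun do under eq_fun do rewrite exprS; exact: udM.
have [D [mD udF]] := udFm n.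
pose B := star K (cst 1%R).
have mB : measurable B by exact: measurable_star.
have volB : (vol B < +oo)%E by apply: (@vol_bounded _ _ _ 1) => // y [].
pose h w := cint (@vol R n) B (fun y => F1 w y ^+ n).
exists rho, h; split => //; split.
  move=> w wr; exists (cint (@vol R n) B (D w)).
  apply: (cint_cdiff mB volB _ _ udF wr) => ? _; [exact: cmeasX|exact: mD].
move=> r rr.
have r0 : 0 < r by apply: lt_trans rr; rewrite invr_gt0.
pose w := r^-1; have w0 : 0 < w by rewrite invr_gt0.
have wrho : w < rho by rewrite -[rho]invrK ltf_pV2 ?posrE ?invr_gt0.
have wt y : `|w * slope y| <= 1 / 4.
  rewrite normrM gtr0_norm//; apply: (@le_trans _ _ (rho * S)); last by lra.
  by rewrite ler_pM ?slope_le// ltW.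
have wq y : `|w ^+ 2 * q y| <= 1 / 2.
  rewrite normrM ger0_norm ?sqr_ge0//; apply: le_trans rQ2.
  by rewrite ler_pM ?sqr_ge0// lerXn2r ?nnegrE ?ltW.
have wq' y : 1 / 2 <= 1 - w ^+ 2 * q y.
  by have := wq y; rewrite ler_norml => /andP[_]; lra.
have mr : measurable_fun setT (radius w).
  apply: measurable_funD; first exact: measurable_funM.
  apply: (measurableT_comp measurable_sqrt); apply: measurable_funB => //.
  exact: measurable_funM.
have hr : homog0 (radius w) by move=> c y c0; rewrite /radius slope_homog.
have bnd y : 1 / 4 <= radius w y <= 3.
  have := wt y; rewrite ler_norml => /andP[t1 t2].
  have := wq y; rewrite ler_norml => /andP[u1 u2].
  have s1 : 1 / 2 <= Num.sqrt (1 - w ^+ 2 * q y).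
    rewrite -[leLHS]ger0_norm; last by lra.
    by rewrite -sqrtr_sqr ler_wsqrtr// expr2; lra.
  have s2 : Num.sqrt (1 - w ^+ 2 * q y) <= 2.
    rewrite -[leRHS]ger0_norm; last by lra.
    by rewrite -sqrtr_sqr ler_wsqrtr// expr2; lra.
  by rewrite /radius -/(q y); lra.
have q4 : 0 < 1 / 4 :> R by lra.
(* Scaling by [w = 1 / r] maps the ball to the unit ball about [w p] and preserves the cone. *)
have volE : vol (cball p r `&` K) = ((r ^+ n)%:E * vol (star K (radius w)))%E.
  rewrite (_ : cball p r `&` K = [set x | star K (radius w) (w *: x + 0)]).
    by rewrite vol_affine// ?exprVn ?invrK//; exact: measurable_star.
  have wr1 : w * r = 1 by rewrite mulVf// gt_eqF.
  have E x : cball p r x <-> enorm (w *: x) <= radius w (w *: x).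
    rewrite radiusP//; last exact: wq'.
    apply: (iff_trans (cballP _ _ (ltW r0))); rewrite !dotZr dotZl.
    rewrite (_ : w * (w * dot x x) - 2 * w * (w * dot p x) + w ^+ 2 * dot p p =
      w ^+ 2 * (dot x x - 2 * dot p x + dot p p)); last by ring.
    by rewrite /w exprVn ler_pdivrMl ?exprn_gt0// mulr1.
  apply/seteqP; split => x [x1 x2]; split; rewrite /= ?addr0 in x1 x2 *.
  - exact/coneK.
  - exact/E.
  - exact/E.
  - exact/(coneK _ w0).
rewrite volE (vol_star q4 coneK hr mK mr bnd).
have FE y : F1 w%:C y ^+ n = (radius w y ^+ n)%:C.
  rewrite [RHS]rmorphXn; congr (_ ^+ _); rewrite /F1.
  rewrite (_ : 1 - w%:C ^+ 2 * (q y)%:C = (1 - w ^+ 2 * q y)%:C).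
    rewrite csqrt_real; last by have := wq' y; lra.
    by rewrite -rmorphM -rmorphD.
  by rewrite -rmorphXn -rmorphM -[X in X - _](rmorph1 (real_complex R)) -rmorphB.
rewrite /h /cint.
under [X in (X +i* _) * _]eq_Rintegral do rewrite FE/=.
under [X in (_ +i* X) * _]eq_Rintegral do rewrite FE/=.
rewrite Rintegral_cst// mul0r complexr0 -rmorphXn -rmorphM/= mulrC fineM//.
have : (@vol R n).-integrable B (EFin \o (fun y => radius w y ^+ n)).
  apply: (@integrable_bounded _ _ _ _ _ _ _ _ (3 ^+ n)) => //; first exact: measurable_funX.
  move=> y; have /andP[b1 b2] := bnd y.
  by rewrite ger0_norm ?exprn_ge0 ?lerXn2r ?nnegrE//; lra.
exact: integrable_fin_num.
Qed.

End Cone.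

(** * Balls cut by a polyhedron *)

Section Polyhedra.
Context {R : realType} (n : nat).
Implicit Types (p x v : 'rV[R]_n).

(** Normal, offset and strictness; with both strict and weak inequalities the complement of a
    half-space is again one. *)
Definition halfspace := ('rV[R]_n * R * bool)%type.
Implicit Types (H : halfspace) (L : seq halfspace).

Definition in_hs x H : bool :=
  if H.2 then dot H.1.1 x < H.1.2 else dot H.1.1 x <= H.1.2.
Definition flip H : halfspace := (- H.1.1, - H.1.2, ~~ H.2).
Definition polyh L : set 'rV[R]_n := [set x | all (in_hs x) L].

Lemma in_hs_flip x H : in_hs x (flip H) = ~~ in_hs x H.
Proof.
case: H => [[a b] []]; rewrite /in_hs/= dotNl.
  by rewrite lerN2 leNgt.
by rewrite ltrN2 ltNge.
Qed.

Lemma measurable_polyh L : measurable (polyh L).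
Proof.
elim: L => [|[[a b] s] L IH].
  by rewrite (_ : polyh _ = setT)//; apply/seteqP; split.
rewrite (_ : polyh _ = [set x | in_hs x (a, b, s)] `&` polyh L); last first.
  by apply/seteqP; split => x /=; rewrite /polyh/= => /andP.
apply: measurableI => //; rewrite /in_hs/=; case: s.
  by apply: measurable_lt_set => //; exact: measurable_dot.
by apply: measurable_le_set => //; exact: measurable_dot.
Qed.

Lemma measurable_cut p r L : measurable (cball p r `&` polyh L).
Proof. by apply: measurableI; [exact: measurable_cball|exact: measurable_polyh]. Qed.

Lemma vol_cut_fin p r L : vol (cball p r `&` polyh L) \is a fin_num.
Proof.
rewrite ge0_fin_numE ?measure_ge0//; apply: le_lt_trans (vol_cball_fin p r).
apply: le_measure; rewrite ?inE; [exact: measurable_cut|exact: measurable_cball|].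
exact: subIsetl.
Qed.

Definition laurent_cut L := forall p,
  laurent n (fun r => fine (vol (cball p r `&` polyh L))).

Lemma laurent_cut_ext L L' : (forall x, all (in_hs x) L = all (in_hs x) L') ->
  laurent_cut L -> laurent_cut L'.
Proof.
by move=> LL' gL p; rewrite (_ : polyh L' = polyh L)//; apply/seteqP; split=> x;
  rewrite /polyh/= LL'.
Qed.

(** The cuts by [H :: L] and [flip H :: L] partition the cut by [L], so the first volume is a
    difference of the other two. *)
Lemma laurent_cut_flip H L :
  laurent_cut L -> laurent_cut (flip H :: L) -> laurent_cut (H :: L).
Proof.
move=> gL gf p; apply: (eq_laurent (r0 := 0) (laurent_lin (-1) (gL p) (gf p))).
move=> r _; rewrite mulN1r; apply/eqP; rewrite subr_eq; apply/eqP.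
rewrite -fineD ?vol_cut_fin// -measureU//; [|exact: measurable_cut..|].
  congr (fine (vol _)); apply/seteqP; split => x; rewrite /polyh/= in_hs_flip.
    by move=> [xp xL]; case: (in_hs x H); [left|right]; split.
  by move=> [[xp /andP[_ xL]]|[xp /andP[_ xL]]].
apply/seteqP; split => // x [[_ /= /andP[xH _]] [_ /= /andP[]]].
by rewrite in_hs_flip xH.
Qed.

(** The marked half-spaces are complemented one at a time, [L2] collecting those already treated;
    each exchange leaves over a cut by [m] half-spaces, which the hypothesis covers. *)
Lemma laurent_cut_flips m (L1 : seq (bool * halfspace)) L2 :
  (forall L, size L = m -> laurent_cut L) -> (size L1 + size L2 = m.+1)%N ->
  laurent_cut ([seq if z.1 then flip z.2 else z.2 | z <- L1] ++ L2) ->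
  laurent_cut ([seq z.2 | z <- L1] ++ L2).
Proof.
move=> gm; elim: L1 L2 => [//|[b H] L1 IH] L2 /= sz g.
apply: (@laurent_cut_ext ([seq z.2 | z <- L1] ++ H :: L2)).
  by move=> x; rewrite /= !all_cat/= andbCA.
apply: IH; first by rewrite -sz addnS.
apply: (@laurent_cut_ext (H :: [seq if z.1 then flip z.2 else z.2 | z <- L1] ++ L2)).
  by move=> x; rewrite /= !all_cat/= andbCA.
case: b g => //; apply: laurent_cut_flip; apply: gm.
by rewrite size_cat size_map; case: sz.
Qed.

(** Translating [v] to the origin makes all offsets 0, so that the polyhedron becomes a cone. *)
Lemma laurent_cut_concurrent L v : {in L, forall H, dot H.1.1 v = H.1.2} -> laurent_cut L.
Proof.
move=> Lv p; pose K := polyh [seq (H.1.1, 0, H.2) | H <- L].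
have mK : measurable K by exact: measurable_polyh.
have cK : cone K.
  move=> c x c0; rewrite /K /polyh/= !all_map.
  rewrite (@eq_all _ _ (preim (fun H => (H.1.1, 0, H.2)) (in_hs x)))// => H.
  rewrite /in_hs/= dotZr; case: H.2.
    by rewrite pmulr_rlt0.
  by rewrite pmulr_rle0.
apply: (eq_laurent (r0 := 0) (laurent_cone (p - v) cK mK)) => r _.
congr fine; rewrite (_ : cball p r `&` polyh L =
    [set x | (cball (p - v) r `&` K) (1 *: x + - v)]).
  rewrite vol_affine// ?expr1n ?invr1 ?mul1e//; apply: measurableI => //.
  exact: measurable_cball.
have E x : (all (in_hs x) L) = all (in_hs (x - v)) [seq (H.1.1, 0, H.2) | H <- L].
  rewrite all_map; apply: eq_in_all => H HL /=.
  by rewrite /in_hs/= dotDr dotNr Lv//; case: H.2; rewrite ?subr_lt0 ?subr_le0.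
apply/seteqP; split => x /=; rewrite scale1r => -[xp xL]; split.
- by move: xp; rewrite /cball/= !eucl_distE (_ : x - v - (p - v) = x - p)//;
    apply/rowP => i; rewrite !mxE; ring.
- by rewrite /K /polyh/= -E.
- by move: xp; rewrite /cball/= !eucl_distE (_ : x - v - (p - v) = x - p)//;
    apply/rowP => i; rewrite !mxE; ring.
- by rewrite /polyh/= E.
Qed.

(** The Fredholm alternative for the equations of the bounding hyperplanes: if they have no
    solution, some column of the cokernel does not annihilate the offsets, and scaling it gives the
    multipliers. *)
Lemma concurrent_or_dependent k (t : k.-tuple halfspace) :
  (exists v, forall i, dot (tnth t i).1.1 v = (tnth t i).1.2) \/
  (exists lam : 'I_k -> R, (forall x, \sum_i lam i * dot (tnth t i).1.1 x = 0) /\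
    \sum_i lam i * (tnth t i).1.2 = -1).
Proof.
pose M : 'M[R]_(n, k) := \matrix_(j, i) (tnth t i).1.1 ord0 j.
pose u : 'rV[R]_k := \row_i (tnth t i).1.2.
have [/submxP[v uE]|] := boolP (u <= M)%MS.
  left; exists v => i; have := congr1 (fun z : 'rV_k => z ord0 i) uE.
  rewrite !mxE => ->; apply: eq_bigr => j _.
  by rewrite mxE mulrC.
rewrite submxE => uM; right.
have [j uj] : exists j, (u *m cokermx M) ord0 j != 0.
  apply/existsP; apply: contra_neqT uM; rewrite negb_exists => /forallP H.
  by apply/rowP => j; rewrite [RHS]mxE; apply/eqP; have := H j; rewrite negbK.
pose c := (u *m cokermx M) ord0 j.
exists (fun i => - c^-1 * cokermx M i j); split.
  move=> x; under eq_bigr do rewrite -mulrA; rewrite -mulr_sumr.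
  rewrite [X in _ * X](_ : _ = (x *m (M *m cokermx M)) ord0 j).
    by rewrite mulmx_coker mulmx0 mxE mulr0.
  rewrite mulmxA mxE; apply: eq_bigr => i _; rewrite mulrC; congr (_ * _).
  by rewrite mxE; apply: eq_bigr => l _; rewrite mxE mulrC.
under eq_bigr do rewrite -mulrA; rewrite -mulr_sumr.
rewrite [X in _ * X](_ : _ = c); first by rewrite mulNr mulVf.
by rewrite /c mxE; apply: eq_bigr => i _; rewrite [u _ _]mxE mulrC.
Qed.

Lemma laurent_cut_polyh L : laurent_cut L.
Proof.
move: {2}(size L) (erefl (size L)) => m; elim: m L => [|m IH] L sL.
  by apply: (@laurent_cut_concurrent _ 0); rewrite (size0nil sL).
have [[v Hv]|[lam [lam0 lam1]]] := concurrent_or_dependent (in_tuple L).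
  by apply: (@laurent_cut_concurrent _ v) => H /(tnthP (in_tuple L))[i ->].
pose L1 := [seq (lam i < 0, tnth (in_tuple L) i) | i <- enum 'I_(size L)].
have L1E : [seq z.2 | z <- L1] = L.
  by rewrite -map_comp /= (map_tnth_enum (in_tuple L)).
rewrite -L1E -[X in laurent_cut X]cats0; apply: laurent_cut_flips IH _ _.
  by rewrite addn0 size_map size_enum_ord.
rewrite cats0 => p.
rewrite (_ : polyh _ = set0).
  by under [X in laurent _ X]eq_fun do rewrite setI0 measure0; exact: laurent0.
apply/seteqP; split => // x /=; rewrite /polyh/= 2!all_map => /allP Lx.
(* At a point of the flipped polyhedron every term is nonpositive, whereas the relations on [lam]
   make the sum equal to 1. *)
have : \sum_i lam i * (dot (tnth (in_tuple L) i).1.1 x - (tnth (in_tuple L) i).1.2) <= 0.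
  apply: sumr_le0 => i _; have := Lx i; rewrite mem_enum => /(_ isT) /=.
  have [li|li] := ltP (lam i) 0.
    rewrite in_hs_flip /in_hs => Hx; rewrite nmulr_rle0// subr_ge0.
    by move: Hx; case: ifP => _; rewrite -?leNgt -?ltNge// => /ltW.
  rewrite /in_hs => Hx; rewrite mulr_ge0_le0// subr_le0.
  by move: Hx; case: ifP => // _ /ltW.
under eq_bigr do rewrite mulrBr; rewrite big_split/= lam0 sumrN lam1 add0r opprK.
by rewrite ler10.
Qed.

End Polyhedra.

(** * Voronoi decomposition *)

(* Breaking ties by the index makes the Voronoi cells disjoint. *)
Definition first_min {R : realType} N (s : 'I_N -> R) (i : 'I_N) :=
  forall j : 'I_N, if (j < i)%N then s i < s j else s i <= s j.

Lemma ex_first_min (R : realType) N (s : 'I_N -> R) : (0 < N)%N ->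
  exists i, first_min s i.
Proof.
move=> N0; pose i0 := Ordinal N0.
(* The witness is the smallest index at which the minimum is attained. *)
pose P (k : nat) := [exists i : 'I_N, (val i == k) && [forall j, s i <= s j]].
have exP : exists k, P k.
  case: (@Order.TotalTheory.arg_minP _ _ _ i0 predT s isT) => i _ si.
  by exists i; apply/existsP; exists i; rewrite eqxx; apply/forallP => j; exact: si.
case: (ex_minnP exP) => k /existsP[i /andP[/eqP ik /forallP si]] kmin.
exists i => j; case: ifPn => ji //; rewrite ltNge; apply/negP => sj.
have : P j.
  by apply/existsP; exists j; rewrite eqxx; apply/forallP => l; exact: le_trans sj _.
by move/kmin; rewrite -ik leqNgt ji.
Qed.

Lemma first_min_uniq (R : realType) N (s : 'I_N -> R) (i j : 'I_N) :
  first_min s i -> first_min s j -> i = j.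
Proof.
move=> mi mj; apply: val_inj; have := mi j; have := mj i; rewrite /=.
case: (ltngtP i j) => //= _ H1 H2.
  by have := lt_le_trans H1 H2; rewrite ltxx.
by have := lt_le_trans H2 H1; rewrite ltxx.
Qed.

Section Voronoi.
Context {R : realType} (n N : nat) (p : 'I_N -> 'rV[R]_n) (e : R).

Definition score x (i : 'I_N) : R :=
  e * (dot x x - 2 * dot (p i) x + dot (p i) (p i)).

(* [e = 1] gives the nearest-point cells and [e = -1] the farthest-point ones. *)
Definition cell (i : 'I_N) : seq (@halfspace R n) :=
  [seq ((2 * e) *: (p j - p i), e * (dot (p j) (p j) - dot (p i) (p i)), (j < i)%N)
     | j <- enum 'I_N].

(** The quadratic term [dot x x] cancels when two scores are compared, which leaves an affine
    inequality. *)
Lemma cellP i x : polyh (cell i) x <-> first_min (score x) i.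
Proof.
have E j : in_hs x ((2 * e) *: (p j - p i),
    e * (dot (p j) (p j) - dot (p i) (p i)), (j < i)%N)
    = if (j < i)%N then score x i < score x j else score x i <= score x j.
  rewrite /in_hs/= dotZl dotDl dotNl /score.
  by case: ifP => _; apply/idP/idP; lra.
rewrite /polyh/= all_map; split.
  by move=> /allP H j; rewrite -E; apply: H; rewrite mem_enum.
by move=> H; apply/allP => j _ /=; rewrite E.
Qed.

(** An abstract body that on each cell coincides with the ball about the centre of that cell; the
    union and the intersection are both instances. *)
Variable U : R -> set 'rV[R]_n.
Hypothesis UE : forall r i x, 0 < r -> first_min (score x) i ->
  U r x <-> cball (p i) r x.
Hypothesis N0 : (0 < N)%N.

Lemma cells_cover r : 0 < r ->
  U r = \bigcup_(i in [set: 'I_N]) (cball (p i) r `&` polyh (cell i)).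
Proof.
move=> r0; apply/seteqP; split => x.
  move=> Ux; have [i mi] := ex_first_min (score x) N0.
  by exists i => //; split; [exact/(UE r0 mi)|exact/cellP].
by move=> [i _ [xi /cellP mi]]; exact/(UE r0 mi).
Qed.

Lemma measurable_cells r : 0 < r -> measurable (U r).
Proof.
move=> r0; rewrite cells_cover//; apply: fin_bigcup_measurable => // i _.
exact: measurable_cut.
Qed.

Lemma vol_cells : exists s : seq 'I_N, forall r, 0 < r ->
  vol (U r) = (\sum_(i <- s) fine (vol (cball (p i) r `&` polyh (cell i))))%:E.
Proof.
have fs : finite_set [set: 'I_N] by exact: finite_finset.
exists (finmap.enum_fset (fset_set [set: 'I_N])) => r r0.
rewrite cells_cover// measure_fin_bigcup//.
- rewrite fsbig_finite//= -sumEFin; apply: eq_bigr => i _.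
  by rewrite fineK// vol_cut_fin.
- by move=> i j _ _ [x [[_ /cellP mi] [_ /cellP mj]]]; exact: first_min_uniq mi mj.
- by move=> i _; exact: measurable_cut.
Qed.

Lemma vol_cells_fin r : 0 < r -> vol (U r) \is a fin_num.
Proof. by have [s E] := vol_cells; move=> r0; rewrite E. Qed.

Lemma laurent_cells : laurent n (fun r => fine (vol (U r))).
Proof.
have [s E] := vol_cells.
apply: (eq_laurent (r0 := 0) (laurent_sum s (fun i => laurent_cut_polyh (cell i) (p i)))).
by move=> r r0; rewrite E.
Qed.

End Voronoi.

(** * The exact order of the pole *)

Section Pole.
Context {R : realType} (n : nat) (U : R -> set 'rV[R]_n).
Local Notation C := R[i].
Variable r0 : R.
Hypothesis r00 : 0 < r0.
Hypothesis mU : forall r, 0 < r -> measurable (U r).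
Hypothesis finU : forall r, 0 < r -> vol (U r) \is a fin_num.
Hypothesis ballU : forall r x, r0 < r -> enorm x <= r / 2 -> U r x.
Hypothesis lU : laurent n (fun r => fine (vol (U r))).

Lemma vol_half_ball : exists2 k : R, 0 < k &
  forall r, 0 < r -> vol [set x : 'rV[R]_n | enorm x <= r / 2] = (r ^+ n * k)%:E.
Proof.
pose k := fine (vol [set x : 'rV[R]_n | enorm x <= 1]).
have fin1 : vol [set x : 'rV[R]_n | enorm x <= 1] \is a fin_num.
  rewrite ge0_fin_numE ?measure_ge0//; apply: (@vol_bounded _ _ _ 1) => //.
  by apply: measurable_le_set => //; exact: measurable_enorm.
have k0 : 0 < k by rewrite -lte_fin fineK// vol_unit_ball_gt0.
exists (k / 2 ^+ n); first by rewrite divr_gt0// exprn_gt0.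
move=> r r1; rewrite (_ : [set x | _] = star setT (fun y => r / 2 * cst 1 y)).
  rewrite vol_star_dilate//; last by rewrite divr_gt0.
  rewrite /star setTI/= -[vol _]fineK// -EFinM -/k; congr EFin.
  by rewrite expr_div_n; ring.
by rewrite /star setTI/=; apply/seteqP; split => x /=; rewrite mulr1.
Qed.

Lemma cdiff_holomorphic (D : set C) (f : C -> C) : open D ->
  (forall z, D z -> exists l, cdiff f z l) -> holomorphic_on D f.
Proof.
by move=> oD df; split => // z /df[l dl]; exists l; exact: cdiff_cvg.
Qed.

Lemma laurent_pole : exists (R0 : R) (F : C -> C),
  holomorphic_on [set z : C | R0%:C < `|z|] F /\
  pole_at_infinity_of_order R0 F n /\
  forall r : R, R0 < r -> exists v : R, vol (U r) = v%:E /\ F r%:C = v%:C.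
Proof.
have [rho [h [rho0 [dh hE]]]] := lU.
exists rho^-1, (fun z => h z^-1 * z ^+ n); split; [|split].
- apply: cdiff_holomorphic; first exact: open_cabs_gt.
  move=> z /=; rewrite cabsE ltcR => rz.
  have z0 : 0 < cabs z by apply: lt_trans rz; rewrite invr_gt0.
  have [l dl] : exists l, cdiff h z^-1 l.
    by apply: dh; rewrite cabsV -[rho]invrK ltf_pV2 ?posrE ?invr_gt0.
  have [k dk] := cdiffX n z.
  eexists; apply: cdiffM dk; apply: (cdiff_comp _ dl); apply: cdiffV.
  by rewrite -cabs_gt0.
- exists rho, h; split => //; split; [|split].
  + apply: cdiff_holomorphic; first exact: open_cabs_lt.
    by move=> z /=; rewrite cabsE ltcR; exact: dh.
  (* If [h 0 = 0], the Lipschitz bound at 0 gives a volume of at most [K r ^ n / r], while the half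
     ball gives at least [k r ^ n]; these conflict once [r > K / k]. *)
  + apply/eqP => h0.
    have [l dl] : exists l, cdiff h 0 l by apply: dh; rewrite cabs0.
    have [K [d [K0 [d0 Kh]]]] := cdiff_lip dl.
    have [k k0 kE] := vol_half_ball.
    (* As a sum of nonnegative thresholds and 1, this [r] exceeds all of them at once. *)
    pose r := r0 + rho^-1 + d^-1 + K / k + 1.
    have i1 : 0 < rho^-1 by rewrite invr_gt0.
    have i2 : 0 < d^-1 by rewrite invr_gt0.
    have i3 : 0 <= K / k by rewrite divr_ge0// ltW.
    have rr0 : r0 < r by rewrite /r; lra.
    have r1 : 0 < r by move: r00; lra.
    have rrho : rho^-1 < r by rewrite /r; move: r00; lra.
    have rd : d^-1 < r by rewrite /r; move: r00; lra.
    have rK : K < r * k by rewrite -ltr_pdivrMr// /r; move: r00; lra.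
    have low : r ^+ n * k <= fine (vol (U r)).
      rewrite -lee_fin fineK ?finU// -kE//; apply: le_measure; rewrite ?inE.
      * by apply: measurable_le_set => //; exact: measurable_enorm.
      * exact: mU.
      * by move=> x; exact: ballU.
    have up : fine (vol (U r)) <= K * r^-1 * r ^+ n.
      have ir : 0 < r^-1 by rewrite invr_gt0.
      have := Kh (r^-1)%:C; rewrite cabs_real gtr0_norm// add0r h0 subr0.
      rewrite -[d]invrK ltf_pV2 ?posrE// => /(_ rd) Kr.
      apply: le_trans (ler_norm _) _; rewrite -cabs_real hE// cabsM.
      have rn0 : 0 <= r ^+ n by rewrite exprn_ge0// ltW.
      by rewrite -rmorphXn/= cabs_real (ger0_norm rn0) ler_wpM2r.
    have : r ^+ n * k <= r ^+ n * (K * r^-1) by apply: le_trans low _; rewrite mulrC.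
    rewrite ler_pM2l ?exprn_gt0// ler_pdivlMr// mulrC.
    by rewrite leNgt rK.
  + move=> w w0 _ _ /=; rewrite invrK; congr (_ * _).
    by rewrite exprVn.
- move=> r rr; exists (fine (vol (U r))).
  have r1 : 0 < r by apply: lt_trans rr; rewrite invr_gt0.
  by rewrite fineK ?finU// hE// fmorphV.
Qed.

End Pole.

Lemma half_ball_sub_cballs (R : realType) n N (p : 'I_N -> 'rV[R]_n) :
  exists2 r0 : R, 0 < r0 & forall r i x, r0 < r -> enorm x <= r / 2 -> cball (p i) r x.
Proof.
pose S (i : 'I_N) := \sum_j `|p i ord0 j|; pose P i := dot (p i) (p i).
have S0 i : 0 <= S i by exact: sumr_ge0.
have P0 i : 0 <= P i by exact: dot_ge0.
pose s := \sum_i (S i + P i).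
have SP i : S i + P i <= s.
  by rewrite /s (bigD1 i)//= lerDl; apply: sumr_ge0 => j _; exact: addr_ge0.
have s0 : 0 <= s by apply: sumr_ge0 => j _; exact: addr_ge0.
(* For [|x| <= r / 2] the squared distance to [p i] is at most [r ^ 2 / 4 + S i * r + P i]; beyond
   this threshold the last two terms are each at most [r ^ 2 / 4]. *)
exists (4 * (1 + s)); first by lra.
move=> r i x rs xr; have := SP i; have := S0 i; have := P0 i => Pi Si SPi.
apply/cballP; first by lra.
have xx : dot x x <= r / 2 * (r / 2).
  by rewrite -sqr_enorm expr2 ler_pM ?enorm_ge0.
have px : `|dot (p i) x| <= S i * (r / 2).
  by apply: le_trans (le_dot_enorm _ _) _; rewrite ler_wpM2l.
move: px; rewrite ler_norml => /andP[px _].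
have Sr : 0 <= (r / 4 - S i) * r by rewrite mulr_ge0//; lra.
have Pr : 0 <= (r / 4 - P i) * r by rewrite mulr_ge0//; lra.
have Pr1 : 0 <= P i * (r - 1) by rewrite mulr_ge0//; lra.
by rewrite -/(P i) expr2; lra.
Qed.

Theorem mainTheorem11 (R : realType) (n N : nat) (p : 'I_N -> 'rV[R]_n) :
  (0 < N)%N ->
  (exists (R0 : R) (F : R[i] -> R[i]),
      holomorphic_on [set z : R[i] | R0%:C < `|z|] F /\
      pole_at_infinity_of_order R0 F n /\
      forall r : R, R0 < r ->
        exists v : R, vol_union p r = v%:E /\ F r%:C = v%:C) /\
  (exists (R0 : R) (F : R[i] -> R[i]),
      holomorphic_on [set z : R[i] | R0%:C < `|z|] F /\
      pole_at_infinity_of_order R0 F n /\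
      forall r : R, R0 < r ->
        exists v : R, vol_inter p r = v%:E /\ F r%:C = v%:C).
Proof.
move=> N0; have [r0 r00 Hr0] := half_ball_sub_cballs p.
(* Both bodies are treated together. The second condition on [U] puts the ball of radius [r / 2]
   about the origin inside it for large [r]. *)
have main (e : R) U : (forall r i x, 0 < r -> first_min (score p e x) i ->
      U r x <-> cball (p i) r x) ->
    (forall r x, (forall i, cball (p i) r x) -> U r x) ->
  exists (R0 : R) (F : R[i] -> R[i]),
  holomorphic_on [set z : R[i] | R0%:C < `|z|] F /\
  pole_at_infinity_of_order R0 F n /\
  forall r : R, R0 < r -> exists v : R, vol (U r) = v%:E /\ F r%:C = v%:C.
  move=> UE Uall; apply: (laurent_pole r00).
  - by move=> r; exact: measurable_cells UE N0 r.
  - by move=> r; exact: vol_cells_fin UE N0 r.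
  - by move=> r x rr xr; apply: Uall => i; exact: Hr0 rr xr.
  - exact: laurent_cells UE N0.
have le_score x i j (r : R) : 0 < r -> score p 1 x i <= score p 1 x j ->
    cball (p j) r x -> cball (p i) r x.
  rewrite /score !mul1r => rp ij /(cballP _ _ (ltW rp)) xj.
  by apply/(cballP _ _ (ltW rp)); exact: le_trans xj.
have fm_le (s : 'I_N -> R) i j : first_min s i -> s i <= s j.
  by move=> /(_ j); case: ifP => // _ /ltW.
split.
  (* A point of some ball lies in the ball about its nearest centre. *)
  apply: (main 1) => [r i x rp mi|r x H].
    split; last by move=> xi; exists i.
    by move=> [j _ xj]; apply: le_score xj => //; exact: fm_le.
  by exists (Ordinal N0) => //; exact: H.
apply: (main (-1)) => [r i x rp mi|r x H i _]; last exact: H.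
(* With [e = -1] the first minimum is a farthest centre, so lying in its ball implies lying in all
   the others. *)
split => [H|xi j _]; first exact: H.
apply: le_score xi => //; have := fm_le _ _ j mi.
by rewrite /score !mulN1r !mul1r lerN2.
Qed.
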